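(* Let $p\in[1,\infty)$, $1/p+1/q=1$, $\alpha\in(0,1]$, and let $f\in L^p(\mathbb{R})$. Then $f\in B^\alpha_p(\mathbb{R})$ if and only if $V^{p,\alpha}(f)<\infty$. Moreover, $$2^{\alpha-1}\|f\|_{p,\alpha}\le V^{p,\alpha}(f)\le\bigl((1+\alpha)^{-1}+1\bigr)\|f\|_{p,\alpha}.$$
   Context: $\|\cdot\|_p$ is the $L^p$-norm with respect to Lebesgue measure on $\mathbb{R}$ and $\|\cdot\|_\infty$ is the sup-norm; if $p=1$ then $q=\infty$. For $h\in\mathbb{R}$ put $f_h(x):=f(x-h)$ and $\|f\|_{p,\alpha}:=\sup_{h\ne0}|h|^{-\alpha}\|f_h-f\|_p\in[0,+\infty]$. The Nikolskii--Besov class $B^\alpha_p(\mathbb{R})$ consists of all $f\in L^p(\mathbb{R})$ for which there is a constant $C$ with $\|f_h-f\|_p\le C|h|^\alpha$ for all $h\in\mathbb{R}$, i.e. $\|f\|_{p,\alpha}<\infty$ (this definition is used also for $\alpha=1$). $C_0^\infty(\mathbb{R})$ is the space of infinitely differentiable compactly supported functions. For $f\in L^p(\mathbb{R})$, $V^{p,\alpha}(f)$ is the infimum of all numbers $C\ge0$ such that $\int_{\mathbb{R}}\varphi'(x)f(x)\,dx\le C\|\varphi\|_q^\alpha\|\varphi'\|_q^{1-\alpha}$ for all $\varphi\in C_0^\infty(\mathbb{R})$; the infimum of the empty set is $+\infty$, and $0^0=1$. *)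

(* Defs.v *)
From HB Require Import structures.
From mathcomp Require Import all_boot all_order all_algebra.
From mathcomp Require Import all_classical all_reals all_analysis.

Set Implicit Arguments.
Unset Strict Implicit.
Unset Printing Implicit Defensive.
Import Order.TTheory GRing.Theory Num.Theory.
Import numFieldNormedType.Exports.

Local Open Scope classical_set_scope.
Local Open Scope ring_scope.

(* f_h (x) = f (x - h) *)
Definition shift_by (R : realType) (h : R) (f : R -> R) : R -> R :=
  fun x => f (x - h).

Definition besov_seminorm (R : realType) (p alpha : R) (f : R -> R) : \bar R :=
  ereal_sup [set ((`|h| `^ (- alpha))%:E *
    'N[@lebesgue_measure R]_(p%:E)[EFin \o (shift_by h f \- f)%R])%E
    | h in [set h : R | h != 0]].

Definition nikolskii_besov (R : realType) (p alpha : R) : set (R -> R) :=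
  [set f | f \in Lfun (@lebesgue_measure R) p%:E /\
    exists C : R, forall h : R,
      ('N[@lebesgue_measure R]_(p%:E)[EFin \o (shift_by h f \- f)%R]
        <= (C * `|h| `^ alpha)%:E)%E].

Definition test_function (R : realType) : set (R -> R) :=
  [set phi | (forall (n : nat) (x : R), derivable (derive1n n phi) x 1) /\
    compact (closure [set x : R | phi x != 0])].

Definition sup_norm (R : realType) (phi : R -> R) : \bar R :=
  ereal_sup [set (`|phi x|)%:E | x in [set: R]].

(* Lnorm at +oo is an essential supremum, whereas a genuine supremum is meant
   here. *)
Definition Lsup_norm (R : realType) (q : \bar R) (phi : R -> R) : \bar R :=
  if q == +oo%E then sup_norm phi
  else 'N[@lebesgue_measure R]_q[EFin \o phi]%E.

(* The integrand is integrable for f in L^p, so the extended-real integral is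
   the usual one.  The library's powers satisfy 0 `^ 0 = 1. *)
Definition Vvar (R : realType) (p alpha : R) (f : R -> R) : \bar R :=
  let q := hoelder_conjugate p%:E in
  ereal_inf [set C%:E | C in [set C : R | 0 <= C /\
    forall phi : R -> R, phi \in @test_function R ->
      (\int[@lebesgue_measure R]_x (derive1 phi x * f x)%:E
        <= C%:E * Lsup_norm q phi `^ alpha
                * Lsup_norm q (derive1 phi) `^ (1 - alpha))%E]].

(* Main.v *)
(** Write N for the norm dual to the p-norm.

    Lower bound: for a test function phi and h > 0, put
    psi(x) = \int_x^(x + h) phi.  Then \int phi (f_h - f) = \int psi' f, while
    N(psi) <= h N(phi) and N(psi') <= 2 N(phi), so that
    \int phi (f_h - f) <= 2^(1 - alpha) C h^alpha N(phi) for every constant C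
    admissible in the definition of V.  Testing against smooth approximations of
    step functions turns this into a bound on the p-norm of f_h - f.

    Upper bound: with G(h) = \int phi'(x + h) f(x) dx, each difference
    G(0) - G(h) is at most N(phi') s h^alpha, where s is the seminorm of f, and
    the integral of G over [0, t] is \int phi (f_t - f), hence at most
    N(phi) s t^alpha.  Integrating over h in [0, t] and dividing by t bounds
    G(0) = \int phi' f by
    N(phi) s t^(alpha - 1) + N(phi') s t^alpha / (1 + alpha);
    take t = N(phi) / N(phi'). *)

Require Import Defs.
From mathcomp Require Import all_boot all_order all_algebra.
From mathcomp Require Import all_classical all_reals all_analysis.
From mathcomp Require Import ring lra measurable_realfun.
Set Implicit Arguments.
Unset Strict Implicit.
Unset Printing Implicit Defensive.
Import Order.TTheory GRing.Theory Num.Theory.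
Import numFieldNormedType.Exports.
Local Open Scope classical_set_scope.
Local Open Scope ring_scope.

(** Averaging over translations links the two quantities: the derivative of a moving integral of phi
    is a difference of translates of phi, and integrating the translates of phi' gives such a
    difference again. The delicate step of the lower bound is duality. The functions attaining
    equality in Hoelder's inequality are not smooth, so step functions are replaced by sums of bumps
    that they dominate in absolute value. Testing against these puts the unknown sum on both sides,
    S <= K S^(1 - 1/p), which can be solved for S only when S is finite. This is why the argument
    runs on finite grids and reaches the function itself only through almost everywhere convergence
    of averages. For p = 1 the dual norm is a supremum and not an integral, so the basic estimates
    of the dual norm split into two cases by [hoelder_conjP]. *)

(** * Translation invariance of Lebesgue measure *)

Section translation.
Context {R : realType}.
Notation mu := (@lebesgue_measure R).
Implicit Types (h : R) (f : R -> \bar R).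
Local Open Scope ereal_scope.

Lemma measurable_addr h : measurable_fun [set: R] (fun x : R => x + h)%R.
Proof. exact: measurable_funD. Qed.

(** Translation preserves the length of half-open intervals, and these lengths determine Lebesgue
    measure. *)
Lemma lebesgue_measure_addr h (A : set R) : measurable A ->
  pushforward mu ((fun x => x + h)%R : R -> measurableTypeR R) A = mu A.
Proof.
move=> mA; apply/esym/lebesgue_measure_unique => //=; first exact: measurable_addr.
move=> mh _ [[a b] _ <-].
rewrite /pushforward.
have -> : (fun x => x + h)%R @^-1` `]a, b]%classic = `](a - h)%R, (b - h)%R]%classic.
  by apply/seteqP; split => x /=; rewrite !in_itv/= ltrBlDr lerBrDr.
rewrite !lebesgue_measure_itv/= !lte_fin ltrD2r.
by case: ifPn => // _; congr EFin; ring.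
Qed.

Lemma ge0_integral_addr h f : measurable_fun [set: R] f -> (forall x, 0 <= f x) ->
  \int[mu]_x f (x + h)%R = \int[mu]_x f x.
Proof.
move=> mf f0.
have mh : measurable_fun setT
    ((fun x => x + h)%R : measurableTypeR R -> measurableTypeR R).
  exact: measurable_addr.
rewrite -(@ge0_integral_pushforward _ _ _ _ _ _ mh mu setT f)//.
by apply: eq_measure_integral => //= A mA _; exact: lebesgue_measure_addr.
Qed.

Lemma integral_addr h f : measurable_fun [set: R] f ->
  \int[mu]_x f (x + h)%R = \int[mu]_x f x.
Proof.
move=> mf; rewrite [LHS]integralE [RHS]integralE.
rewrite -(@ge0_integral_addr h f^\+)//; last exact: measurable_funepos.
rewrite -(@ge0_integral_addr h f^\-)//; last exact: measurable_funeneg.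
by congr (_ - _); apply: eq_integral => x _; rewrite ?(funeposE, funenegE).
Qed.

Lemma Lnorm_addr h (p : R) (f : R -> R) : measurable_fun [set: R] f ->
  'N[mu]_(p%:E)[EFin \o (fun x => f (x + h)%R)] = 'N[mu]_(p%:E)[EFin \o f].
Proof.
move=> mf; rewrite unlock; congr (_ `^ _)%E.
rewrite (@ge0_integral_addr h (fun x => `|(EFin \o f) x| `^ p))//.
  apply/measurable_EFinP.
  apply: (@measurableT_comp _ _ _ _ _ _ (fun x => x `^ p)%R) => //.
  exact: measurableT_comp.
by move=> x; exact: poweR_ge0.
Qed.

End translation.

(** * The norm dual to the p-norm *)

Section sup_norm.
Context {R : realType}.
Implicit Types phi psi : R -> R.
Local Open Scope ereal_scope.

Lemma le_sup_norm phi x : `|phi x|%:E <= sup_norm phi.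
Proof. by apply: ereal_sup_ubound; exists x. Qed.

Lemma sup_norm_le phi (a : \bar R) : (forall x, `|phi x|%:E <= a) -> sup_norm phi <= a.
Proof. by move=> h; apply: ge_ereal_sup => _ [x _ <-]. Qed.

End sup_norm.

Section conjugate_norm.
Context {R : realType}.
Notation mu := (@lebesgue_measure R).
Variable p : R.
Hypothesis p1 : 1 <= p.
Notation q := (hoelder_conjugate p%:E).
Notation N := (Lsup_norm q).
Implicit Types phi psi g : R -> R.
Local Open Scope ereal_scope.

(** Destructing [hoelder_conjP] replaces [q] in the goal by [+oo] or by a real r, so that the test
    in [Lsup_norm] reduces. *)
Variant conj_spec : \bar R -> Type :=
| ConjInf of p = 1%R : conj_spec +oo
| ConjFin r of (1 < p)%R & (1 < r)%R & (p^-1 + r^-1 = 1)%R : conj_spec r%:E.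

Lemma hoelder_conjP : conj_spec q.
Proof.
have [p_eq1|p_neq1] := eqVneq p 1%R.
  by rewrite p_eq1 hoelder_conjugate1; constructor.
have lt1p : (1 < p)%R by rewrite lt_neqAle eq_sym p_neq1.
have p0 : (0 < p)%R by exact: lt_trans lt1p.
have -> : q = (p / (p - 1))%:E.
  rewrite /hoelder_conjugate /= eqe gt_eqF// -EFinB inver subr_eq0.
  by rewrite (negbTE p_neq1).
constructor => //; first by rewrite ltr_pdivlMr ?subr_gt0// mul1r gtrBl.
by rewrite invf_div; field; rewrite gt_eqF.
Qed.

Lemma Lsup_norm_ge0 phi : 0 <= N phi.
Proof.
rewrite /Lsup_norm; case: ifPn => _; last exact: Lnorm_ge0.
by apply: le_trans (le_sup_norm phi 0%R); rewrite lee_fin.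
Qed.

Lemma hoelder_Lsup_norm phi g : measurable_fun setT phi -> measurable_fun setT g ->
  \int[mu]_x `|phi x * g x|%:E <= N phi * 'N[mu]_(p%:E)[EFin \o g].
Proof.
move=> mphi mg; rewrite /Lsup_norm.
case: hoelder_conjP => [-> | r ltp ltr pr] /=.
  rewrite Lnorm1 -ge0_integralZl//; last 2 first.
  - by apply/measurable_EFinP; apply: measurableT_comp.
  - by apply: le_trans (le_sup_norm phi 0%R); rewrite lee_fin.
  apply: ge0_le_integral => //.
  - by apply/measurable_EFinP; apply: measurableT_comp => //; exact: measurable_funM.
  - apply: emeasurable_funM => //.
    by apply/measurable_EFinP; apply: measurableT_comp.
  - by move=> x _; rewrite normrM EFinM lee_wpmul2r// ?lee_fin// le_sup_norm.
rewrite muleC; have := @hoelder _ _ _ mu g phi p r mg mphi.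
rewrite Lnorm1 => /(_ _ _ pr) h; under eq_integral do rewrite mulrC.
by apply: h; apply: lt_trans ltr01 _.
Qed.

Lemma Lsup_norm_addr (h : R) phi : measurable_fun setT phi ->
  N (fun x => phi (x + h)%R) = N phi.
Proof.
move=> mphi; rewrite /Lsup_norm.
case: hoelder_conjP => [_|r _ _ _] /=; last exact: Lnorm_addr.
apply/eqP; rewrite eq_le; apply/andP; split; apply: sup_norm_le => x.
  exact: le_sup_norm.
by have := le_sup_norm (fun x => phi (x + h)%R) (x - h); rewrite subrK.
Qed.

Lemma Lsup_normB phi psi : measurable_fun setT phi -> measurable_fun setT psi ->
  N (phi \- psi)%R <= N phi + N psi.
Proof.
move=> mphi mpsi; rewrite /Lsup_norm.
case: hoelder_conjP => [_|r _ r1 _] /=.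
  apply: sup_norm_le => x.
  apply: (@le_trans _ _ (`|phi x|%:E + `|psi x|%:E)).
    by rewrite lee_fin ler_normB.
  by rewrite leeD// le_sup_norm.
rewrite -[X in _ + X](oppe_Lnorm mu).
by apply: minkowski_EFin => //; [exact: measurableT_comp|exact: ltW].
Qed.

Lemma Lsup_norm_lty phi (M B : R) : measurable_fun setT phi ->
  (forall x, `|phi x| <= B)%R -> (forall x, M < `|x| -> phi x = 0)%R ->
  N phi < +oo.
Proof.
move=> mphi phiB phi0; rewrite /Lsup_norm.
case: hoelder_conjP => [_|r _ r1 _] /=.
  apply: (@le_lt_trans _ _ B%:E); last exact: ltry.
  by apply: sup_norm_le => x; rewrite lee_fin.
have r0 : (0 < r)%R by exact: lt_trans r1.
rewrite unlock poweR_lty//.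
pose y := \int[mu]_(x in `[(- M)%R, M]%classic) (B `^ r)%:E.
apply: (@le_lt_trans _ _ y); rewrite /y.
  rewrite [leRHS]integral_mkcond; apply: ge0_le_integral => //.
  - by move=> x _; rewrite poweR_ge0.
  - apply/measurable_EFinP.
    apply: (@measurableT_comp _ _ _ _ _ _ (fun x => x `^ r)%R) => //.
    exact: measurableT_comp.
  - by apply/(measurable_restrictT _ _).1 => //; exact: measurable_cst.
  - move=> x _ /=; rewrite patchE; case: ifPn => xM.
      (* The bound at 0 serves to show B >= 0. *)
      by rewrite lee_fin ge0_ler_powR ?nnegrE ?(ltW r0)//; exact: le_trans (phiB 0%R).
    rewrite phi0 ?normr0 ?powR0 ?gt_eqF//.
    move: xM; rewrite notin_setE/= in_itv/= => /negP.
    by rewrite -ler_norml -ltNge.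
rewrite integral_cst//= lebesgue_measure_itv/=.
by case: ifPn => _; rewrite ?mule0 ?ltry// -EFinB -EFinM ltry.
Qed.

End conjugate_norm.

(* [integral_window] replaces Minkowski's integral inequality: Hoelder on each
   window of length h, then Tonelli, bounds the norm of a moving integral. *)
Section average.
Context {R : realType}.
Notation mu := (@lebesgue_measure R).
Implicit Types phi psi g : R -> R.
Local Open Scope ereal_scope.

(** Turns the integral over a moving interval into a section of a function on the plane, as Tonelli
    requires: [z.1] is the left end of the interval and [z.2] the variable of integration. *)
Let window (h : R) (F : R -> \bar R) (z : R * R) : \bar R :=
  if (z.1 <= z.2 <= z.1 + h)%R then F z.2 else 0.

Let measurable_window h F : measurable_fun setT F -> measurable_fun setT (window h F).
Proof.
move=> mF; apply: measurable_fun_ifT => //; last exact: measurableT_comp.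
apply: measurable_and; apply: measurable_fun_ler => //.
exact: measurable_funD.
Qed.

Let window_ge0 h F : (forall y, 0 <= F y) -> forall z, 0 <= window h F z.
Proof. by move=> F0 z; rewrite /window; case: ifP. Qed.

Let integral_windowE h F x :
  \int[mu]_(y in `[x, (x + h)%R]%classic) F y = \int[mu]_y window h F (x, y).
Proof.
rewrite integral_mkcond; apply: eq_integral => y _.
by rewrite patchE /window mem_setE in_itv.
Qed.

Lemma measurable_integral_window (h : R) (F : R -> \bar R) :
  measurable_fun setT F -> (forall y, 0 <= F y) ->
  measurable_fun setT (fun x : R => \int[mu]_(y in `[x, (x + h)%R]%classic) F y).
Proof.
move=> mF F0; under eq_fun do rewrite integral_windowE.
exact: (@measurable_fun_fubini_tonelli_F _ _ _ _ _ mu _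
  (measurable_window h mF) (window_ge0 h F0)).
Qed.

Lemma integral_window (h : R) (F : R -> \bar R) : (0 <= h)%R ->
  measurable_fun setT F -> (forall y, 0 <= F y) ->
  \int[mu]_x \int[mu]_(y in `[x, (x + h)%R]%classic) F y = h%:E * \int[mu]_y F y.
Proof.
move=> h0 mF F0; under eq_integral do rewrite integral_windowE.
transitivity (\int[mu]_y \int[mu]_x window h F (x, y)).
  exact: (@fubini_tonelli _ _ _ _ _ mu mu _ (measurable_window h mF) (window_ge0 h F0)).
rewrite -ge0_integralZl//.
apply: eq_integral => y _.
(* For fixed y, the windows that contain y are those with x in [y - h, y], an interval of length
   h. *)
transitivity (\int[mu]_(x in `[(y - h)%R, y]%classic) F y).
  rewrite [RHS]integral_mkcond.
  apply: eq_integral => x _; rewrite patchE /window/=.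
  by rewrite mem_setE in_itv/= lerBlDr andbC.
rewrite integral_cst//= lebesgue_measure_itv/= lte_fin.
case: ifPn => [_|]; first by rewrite -EFinB opprB addrCA subrr addr0 muleC.
rewrite -leNgt => hy; have -> : h = 0%R by lra.
by rewrite mul0e mule0.
Qed.

Variable p : R.
Hypothesis p1 : (1 <= p)%R.
Notation q := (hoelder_conjugate p%:E).
Notation N := (Lsup_norm q).

Lemma Lsup_norm_average (h : R) phi psi : (0 < h)%R ->
  measurable_fun setT phi -> measurable_fun setT psi ->
  (forall x, `|psi x|%:E <= \int[mu]_(y in `[x, (x + h)%R]%classic) `|phi y|%:E) ->
  N psi <= h%:E * N phi.
Proof.
move=> h0 mphi mpsi psi_le; rewrite /Lsup_norm.
have mI x : mu `[x, (x + h)%R]%classic = h%:E.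
  by rewrite lebesgue_measure_itv/= lte_fin ltrDl h0 -EFinB; congr EFin; ring.
case: (hoelder_conjP p1) => [_|r ltp ltr pr] /=.
  apply: sup_norm_le => x; apply: (le_trans (psi_le x)).
  rewrite muleC -(mI x) -integral_cst//.
  apply: ge0_le_integral => //.
  - apply/measurable_EFinP; apply: measurableT_comp => //.
    exact: measurable_funTS.
  - by move=> y _; exact: le_sup_norm.
have r0 : (0 < r)%R by exact: lt_trans ltr.
have p0 : (0 < p)%R by exact: lt_trans ltp.
have mpow (f : R -> R) : measurable_fun setT f -> measurable_fun setT (fun x => `|f x| `^ r)%R.
  move=> mf; apply: (@measurableT_comp _ _ _ _ _ _ (fun x => x `^ r)%R) => //.
  exact: measurableT_comp.
(* Hoelder against the indicator of the window, whose p-norm is h^(1/p), raised to the power r;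
   conjugacy gives r / p = r - 1. *)
have pointwise x : (`|psi x| `^ r)%:E <=
    (h `^ (r - 1))%:E * \int[mu]_(y in `[x, (x + h)%R]%classic) (`|phi y| `^ r)%:E.
  pose A := `[x, (x + h)%R]%classic : set R.
  have mA0 : measurable A by exact: measurable_itv.
  have H : `|psi x|%:E <= (h `^ p^-1)%:E *
      (\int[mu]_(y in A) (`|phi y| `^ r)%:E) `^ r^-1.
    apply: (le_trans (psi_le x)).
    have mA : measurable_fun setT (\1_A : R -> R) by exact: measurable_indic.
    have := @hoelder _ _ _ mu \1_A (phi \* \1_A)%R p r mA
      (measurable_funM mphi mA) p0 r0 pr.
    rewrite Lnorm1 => H; apply: le_trans (le_trans H _).
      rewrite [leLHS]integral_mkcond; apply: ge0_le_integral => //.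
      - by move=> y _; rewrite patchE; case: ifPn => _; rewrite ?lee_fin.
      - apply/(measurable_restrictT _ _).1 => //; apply: measurable_funTS.
        by apply/measurable_EFinP; exact: measurableT_comp.
      - apply: measurableT_comp => //; apply/measurable_EFinP.
        by apply: measurable_funM => //; exact: measurable_funM.
      - move=> y _; rewrite patchE /= indicE; case: (y \in A) => /=.
          by rewrite mul1r mulr1.
        by rewrite mul0r normr0.
    have I1 : \int[mu]_y (`|(EFin \o \1_A) y| `^ p) = h%:E.
      rewrite -(mI x) -[X in mu X]setIT -integral_indic//.
      apply: eq_integral => y _; rewrite /= indicE.
      by case: (y \in A); rewrite ?normr1 ?powR1 ?normr0 ?powR0 ?gt_eqF.
    have I2 : \int[mu]_y (`|(EFin \o (phi \* \1_A)%R) y| `^ r) =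
        \int[mu]_(y in A) (`|phi y| `^ r)%:E.
      rewrite [RHS]integral_mkcond; apply: eq_integral => y _.
      rewrite patchE /= indicE.
      by case: (y \in A); rewrite ?mulr1 ?mulr0 ?normr0 ?powR0 ?gt_eqF.
    by rewrite unlock I1 I2 poweR_EFin.
  have := H; rewrite -/A; set I := \int[mu]_(y in A) _ => {}H.
  have I0 : 0 <= I by apply: integral_ge0 => y _; rewrite lee_fin powR_ge0.
  have hH : (`|psi x|%:E) `^ r <= ((h `^ p^-1)%:E * I `^ r^-1) `^ r.
    apply: gt0_ler_poweR => //; first exact: ltW.
      by rewrite in_itv/= lee_fin normr_ge0 leey.
    by rewrite in_itv/= leey andbT mule_ge0 ?poweR_ge0// lee_fin powR_ge0.
  apply: (le_trans hH); rewrite poweRM ?poweR_ge0 ?lee_fin ?powR_ge0//.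
  rewrite -poweRrM mulVf ?gt_eqF// poweRe1// poweR_EFin -powRrM.
  suff -> : (p^-1 * r = r - 1)%R by [].
  have -> : (p^-1 = 1 - r^-1)%R by lra.
  by rewrite mulrBl mul1r mulVf// gt_eqF.
(* Writing h as (h^r)^(1/r) makes both sides r-th roots. Of h^r = h^(r - 1) h, the first factor
   comes from Hoelder and the second from Tonelli. *)
rewrite unlock -[X in X * _](@poweRe1 _ h%:E) ?lee_fin ?(ltW h0)//.
rewrite -[X in _ `^ X * _](@divff _ r) ?gt_eqF// poweRrM.
rewrite -poweRM ?poweR_ge0//; last by apply: integral_ge0 => x _; exact: poweR_ge0.
have E : (h%:E `^ r = (h `^ (r - 1))%:E * h%:E).
  by rewrite poweR_EFin -EFinM mulrC mulr_powRB1// ltW.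
apply: gt0_ler_poweR; rewrite ?invr_ge0 ?(ltW r0)//.
- by rewrite in_itv/= leey andbT; apply: integral_ge0 => x _; rewrite lee_fin powR_ge0.
- rewrite in_itv/= leey andbT mule_ge0 ?lee_fin ?powR_ge0//.
  by apply: integral_ge0 => x _; rewrite lee_fin powR_ge0.
rewrite E -muleA -(@integral_window h (fun y => (`|phi y| `^ r)%:E)) ?(ltW h0)//; last first.
  by apply/measurable_EFinP; exact: mpow.
have mphir : measurable_fun setT (fun y => (`|phi y| `^ r)%:E).
  by apply/measurable_EFinP; exact: mpow.
have mw := @measurable_integral_window h _ mphir.
rewrite -ge0_integralZl//; last 3 first.
- by apply: mw => y; rewrite lee_fin powR_ge0.
- by move=> x _; apply: integral_ge0 => y _; rewrite lee_fin powR_ge0.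
- by rewrite lee_fin powR_ge0.
apply: ge0_le_integral => //.
- by move=> x _; exact: poweR_ge0.
- by apply/measurable_EFinP; exact: mpow.
- by apply: measurable_funeM; apply: mw => y; rewrite lee_fin powR_ge0.
- by move=> x _; exact: pointwise.
Qed.

End average.

(** * Smooth functions *)

Section flat_functions.
Context {R : realType}.
Implicit Types (P : {poly R}) (x y : R).

(* The family is closed under differentiation: P(1/x) exp(-1/x) has derivative
   (X^2 (P - P'))(1/x) exp(-1/x), also at 0. *)
Definition flat P x : R := if 0 < x then P.[x^-1] * expR (- x^-1) else 0.

(** For y >= 1 lower powers are dominated by higher ones. With y = 1/x this is the growth that
    exp(-y) has to beat. *)
Lemma horner_le_expn P :
  exists A m, 0 <= A /\ forall y, 1 <= y -> `|P.[y]| <= A * y ^+ m.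
Proof.
elim/poly_ind: P => [|P c [A [m [A0 IH]]]].
  by exists 0, 0%N; split => // y _; rewrite horner0 normr0 mul0r.
exists (A + `|c|), m.+1; split; first by rewrite addr_ge0.
move=> y y1; have y0 : 0 <= y by apply: le_trans y1.
rewrite hornerMXaddC (le_trans (ler_normD _ _))// mulrDl lerD//.
  by rewrite normrM (ger0_norm y0) exprSr mulrA ler_wpM2r// IH.
by rewrite ler_peMr// exprn_ege1.
Qed.

(** With y = 1/x, exp(y) is at least y^(m + 1) / (m + 1)!, one power more than the polynomial bound
    A y^m; the spare power is the factor |x|. *)
Lemma flat_le P : exists C, forall x, `|x| <= 1 -> `|flat P x| <= C * `|x|.
Proof.
have [A [m [A0 PA]]] := horner_le_expn P.
exists (A * (m.+1)`!%:R) => x x1; rewrite /flat.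
case: ifPn => [x0|_]; last by rewrite normr0 !mulr_ge0.
have y1 : 1 <= x^-1.
  by rewrite invf_ge1//; move: x1; rewrite (gtr0_norm x0).
rewrite normrM (gtr0_norm (expR_gt0 _)) (gtr0_norm x0) expRN.
rewrite ler_pdivrMr ?expR_gt0//.
apply: (le_trans (PA _ y1)); rewrite -!mulrA ler_wpM2l//.
have h := @expR_ge1Dxn R x^-1 m; rewrite invr_ge0 (ltW x0) in h.
have {}h := h isT; have {}h : x^-1 ^+ m.+1 / (m.+1)`!%:R <= expR x^-1 by lra.
move: h; rewrite ler_pdivrMr ?ltr0n ?fact_gt0// => h.
have -> : x^-1 ^+ m = x * x^-1 ^+ m.+1.
  by rewrite exprS mulrA divff ?mul1r// gt_eqF.
rewrite (le_trans (ler_wpM2l (ltW x0) h))//.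
by rewrite le_eqVlt; apply/orP; left; apply/eqP; ring.
Qed.

Lemma continuous_flat0 P : {for 0, continuous (flat P)}.
Proof.
have [C hC] := flat_le P.
have f0 : flat P 0 = 0 by rewrite /flat ltxx.
suff : flat P x @[x --> (0 : R)] --> (0 : R) by rewrite -[X in _ --> X]f0.
apply/cvgr0Pnorm_le => e e0.
have C0 : 0 <= C.
  have := hC 1; rewrite normr1 mulr1 => /(_ (lexx _)); exact: le_trans.
near=> x.
have x1 : `|x| <= 1 by near: x; exact: (@nbhs0_le R R).
(* C may be 0, so the division is by C + 1. *)
have xe : `|x| <= e / (C + 1) by near: x; apply: (@nbhs0_le R R); rewrite divr_gt0// ltr_wpDl.
apply: (le_trans (hC x x1)).
apply: (@le_trans _ _ ((C + 1) * `|x|)); first by rewrite ler_wpM2r// lerDl.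
by rewrite mulrC -ler_pdivlMr ?ltr_wpDl.
Unshelve. all: by end_near. Qed.

Lemma is_derive_flat P x :
  is_derive x 1 (flat P) (flat ('X ^+ 2 * (P - P^`())) x).
Proof.
have [x0|x0|->] := ltgtP x 0.
- have -> : flat ('X^2 * (P - P^`())) x = 0 by rewrite /flat ltNge (ltW x0).
  apply: (@near_eq_is_derive _ _ _ (cst 0)).
  near=> z; rewrite /flat ltNge (ltW _)//; near: z; exact: lt_nbhsl.
- apply: (@near_eq_is_derive _ _ _ (fun x => P.[x^-1] * expR (- x^-1))).
    by near=> z; rewrite /flat ifT//; near: z; exact: lt_nbhsr.
  have xn0 : x != 0 by rewrite gt_eqF.
  have dV : is_derive x 1 (fun y : R => y^-1) (- x ^- 2 *: 1).
    exact: (@is_deriveV _ id).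
  have d1 := is_derive1_comp (is_derive_poly P x^-1) dV.
  have d2 := @is_derive1_comp R expR (fun y => - y^-1) x _ _
    (is_derive_expR (- x^-1)) (is_deriveN dV).
  apply: is_derive_eq (is_deriveM d1 d2) _.
  rewrite /flat x0 /= !hornerE /GRing.scale/=.
  by field.
(* At 0 the difference quotient of [flat P] is again of this family: dividing by x multiplies the
   polynomial in 1/x by X. *)
- apply/is_derive1_caratheodory; exists (flat ('X * P)); split.
  + move=> z; rewrite /flat ltxx !subr0.
    case: ifPn => z0; last by rewrite mul0r.
    by rewrite !hornerE/=; field; rewrite gt_eqF.
  + exact: continuous_flat0.
  + by rewrite /flat ltxx.
Unshelve. all: by end_near. Qed.

Definition smooth (f : R -> R) := forall n x, derivable (derive1n n f) x 1.

Lemma smoothP f : smooth f <-> (forall x, derivable f x 1) /\ smooth (derive1 f).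
Proof.
split=> [sf|[df sf] [|n] x]; last 2 first.
- exact: df.
- by rewrite derive1Sn; exact: sf.
by split=> [x|n x]; [exact: (sf 0%N)|rewrite -derive1Sn; exact: sf].
Qed.

(** Avoids formulas for higher derivatives: smoothness follows by exhibiting a class closed under
    differentiation. *)
Lemma smooth_coind (S : set (R -> R)) :
  (forall f, S f -> (forall x, derivable f x 1) /\ S (derive1 f)) ->
  forall f, S f -> smooth f.
Proof.
move=> HS f Sf n; elim: n f Sf => [|n IH] f Sf x.
  by have [] := HS _ Sf.
by rewrite derive1Sn; apply: IH; have [] := HS _ Sf.
Qed.

(** A class for [smooth_coind] that contains linear combinations of bumps. The affine argument gives
    bumps on any interval, with a < 0 for the right end. *)
Inductive flat_ring : (R -> R) -> Prop :=
| flat_ring_flat P a b : flat_ring (fun x => flat P (a * x + b))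
| flat_ring_cst c : flat_ring (cst c)
| flat_ringD f g : flat_ring f -> flat_ring g -> flat_ring (f \+ g)
| flat_ringM f g : flat_ring f -> flat_ring g -> flat_ring (f \* g).

Lemma flat_ring_derive f : flat_ring f ->
  exists2 g, flat_ring g & forall x, is_derive x 1 f (g x).
Proof.
elim=> {f}.
- move=> P a b.
  exists (fun x => flat ('X ^+ 2 * (P - P^`())) (a * x + b) * cst a x).
    by apply: flat_ringM; constructor.
  move=> x; apply: (@is_derive1_comp _ (flat P) (fun x => a * x + b)).
    exact: is_derive_flat.
  by apply: is_derive_eq; rewrite /GRing.scale/= mulr1 addr0.
- move=> c; exists (cst 0); first by constructor.
  by move=> x; exact: is_derive_cst.
- move=> f g _ [f' f'r df] _ [g' g'r dg]; exists (f' \+ g').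
    exact: flat_ringD.
  by move=> x; exact: is_deriveD.
- move=> f g fr [f' f'r df] gr [g' g'r dg]; exists (f \* g' \+ g \* f').
    by apply: flat_ringD; exact: flat_ringM.
  by move=> x; exact: is_deriveM.
Qed.

Lemma flat_ring_smooth f : flat_ring f -> smooth f.
Proof.
apply: smooth_coind => {}f /flat_ring_derive[g gr dg]; split => [x|].
  exact: ex_derive.
suff -> : derive1 f = g by [].
by apply/funext => x; rewrite derive1E derive_val.
Qed.

(** Compactness of the support is traded for vanishing outside [-M, M], the form in which supports
    are used below. *)
Lemma test_functionP (phi : R -> R) : test_function phi <->
  smooth phi /\ exists M, forall x, M < `|x| -> phi x = 0.
Proof.
split=> [[sphi cphi]|[sphi [M phi0]]]; split => //.
  have [M [_ HM]] := compact_bounded cphi.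
  (* [compact_bounded] yields a bound by each number strictly above M, hence M + 1. *)
  exists (M + 1) => x Mx; apply/eqP; apply: contraTT Mx => phix.
  rewrite -leNgt; apply: (HM (M + 1)); first by rewrite ltrDl.
  exact: subset_closure.
apply: (@subclosed_compact _ _ `[- M, M]%classic).
- exact: closed_closure.
- exact: segment_compact.
- have <- : closure (`[- M, M]%classic : set R) = `[- M, M]%classic.
    by apply/esym/closure_id; exact: itv_closed.
  apply: closure_subset => x /= phix; rewrite in_itv/= -ler_norml leNgt.
  by apply: contra phix => /phi0 ->.
Qed.

(* Tends to the indicator function of ]a, b[ as c tends to infinity. *)
Definition flat_bump (c a b x : R) : R :=
  flat 1 (c * x + - (c * a)) * flat 1 (- c * x + c * b).

Lemma flat1_itv x : 0 <= flat 1 x <= 1.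
Proof.
rewrite /flat; case: ifPn => [x0|_]; last by rewrite lexx ler01.
by rewrite hornerE mul1r expR_ge0 expR_le1 oppr_le0 invr_ge0 ltW.
Qed.

Lemma flat_bump_itv c a b x : 0 <= flat_bump c a b x <= 1.
Proof.
have /andP[u0 u1] := flat1_itv (c * x + - (c * a)).
have /andP[v0 v1] := flat1_itv (- c * x + c * b).
by rewrite /flat_bump mulr_ge0//= mulr_ile1.
Qed.

Lemma flat_bump0 c a b x : 0 < c -> ~~ (a < x < b) -> flat_bump c a b x = 0.
Proof.
move=> c0; rewrite negb_and -!leNgt /flat_bump /flat => /orP[xa|bx].
  by rewrite ltNge -mulrBr pmulr_rle0// subr_le0 xa mul0r.
rewrite [X in _ * X]ifF ?mulr0//; apply/negbTE; rewrite -leNgt.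
by rewrite mulNr addrC -mulrBr pmulr_rle0// subr_le0.
Qed.

(** Each factor is exp(-1/((k + 1) y)) with y > 0 the distance from x to an endpoint, and its
    exponent tends to 0. *)
Lemma flat_bump_cvg a b x : a < x < b -> flat_bump k.+1%:R a b x @[k --> \oo] --> (1 : R).
Proof.
move=> /andP[ax xb].
have H (y : R) : 0 < y -> flat 1 (k.+1%:R * y) @[k --> \oo] --> (1 : R).
  move=> y0; rewrite /flat.
  under eq_fun do rewrite pmulr_rgt0// y0 hornerE mul1r invfM.
  have h0 : - (k.+1%:R^-1 * y^-1) @[k --> \oo] --> (0 : R).
    rewrite -[0]oppr0 -[0](mul0r y^-1); apply: cvgN; apply: cvgMl.
    exact: cvg_harmonic.
  have := continuous_cvg _ (@continuous_expR R 0) h0; rewrite expR0.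
  by apply.
have hl : flat 1 (k.+1%:R * x + - (k.+1%:R * a)) @[k --> \oo] --> (1 : R).
  by under eq_fun do rewrite -mulrBr; apply: H; rewrite subr_gt0.
have hr : flat 1 (- k.+1%:R * x + k.+1%:R * b) @[k --> \oo] --> (1 : R).
  by under eq_fun do rewrite mulNr addrC -mulrBr; apply: H; rewrite subr_gt0.
have := cvgM hl hr; rewrite mulr1. apply.
Qed.

Lemma flat_bump_flat_ring c a b : flat_ring (flat_bump c a b).
Proof. by apply: flat_ringM; constructor. Qed.

End flat_functions.

(** * Test functions and their moving integrals *)

Section test_functions.
Context {R : realType}.
Notation mu := (@lebesgue_measure R).
Implicit Types (f phi : R -> R) (M h : R).

Lemma smooth_continuous phi : smooth phi -> continuous phi.
Proof.
move=> /smoothP[dphi _] x; apply: differentiable_continuous.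
exact/derivable1_diffP.
Qed.

Lemma smooth_is_derive phi (x : R) : smooth phi -> is_derive x 1 phi (derive1 phi x).
Proof. by move=> /smoothP[dphi _]; rewrite derive1E; exact: DeriveDef. Qed.

Lemma smooth_derive1 phi : smooth phi -> smooth (derive1 phi).
Proof. by move=> /smoothP[]. Qed.

Lemma is_derive_addr phi (x h d : R) : is_derive (x + h) 1 phi d ->
  is_derive x 1 (fun y => phi (y + h)) d.
Proof.
move=> dphi.
have dh : is_derive x 1 (fun y : R => y + h) 1.
  by apply: is_derive_eq (is_deriveD (is_derive_id x 1) (is_derive_cst h x 1)) _; rewrite addr0.
have := @is_derive1_comp R phi (fun y => y + h) x d 1 dphi dh.
by rewrite mulr1.
Qed.

Lemma smooth_diff phi h : smooth phi -> smooth (fun x => phi (x + h) - phi x).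
Proof.
move=> sphi.
pose S : set (R -> R) := [set f | exists2 g, smooth g & f = fun x => g (x + h) - g x].
apply: (@smooth_coind _ S); last by exists phi.
move=> _ [g sg ->].
have dg (x : R) : is_derive x 1 (fun x => g (x + h) - g x) (derive1 g (x + h) - derive1 g x).
  by apply: is_deriveB; [apply: is_derive_addr|]; exact: smooth_is_derive.
split=> [x|]; first exact: ex_derive.
exists (derive1 g); first exact: smooth_derive1.
by apply/funext => x; rewrite derive1E derive_val.
Qed.

(** The strict inequality defines an open set, so phi vanishes on a neighbourhood of each of its
    points. *)
Lemma derive1_supp phi M : (forall x, M < `|x| -> phi x = 0) ->
  forall x, M < `|x| -> derive1 phi x = 0.
Proof.
move=> phi0 x Mx; rewrite derive1E (@near_eq_derive _ _ _ _ (cst 0)).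
  by rewrite derive_cst.
near=> z; apply: phi0; near: z.
have : continuous (fun z : R => `|z|) by exact: norm_continuous.
move=> /(_ x) /cvgr_gt; exact.
Unshelve. all: by end_near. Qed.

Lemma compact_supp_bounded phi M : continuous phi -> (forall x, M < `|x| -> phi x = 0) ->
  exists2 B : R, 0 <= B & forall x, `|phi x| <= B.
Proof.
move=> cphi phi0; have [M0|M0] := ltP M 0.
  by exists 0 => // x; rewrite phi0 ?normr0// (lt_le_trans M0).
have cn : {within `[- M, M], continuous (fun x => `|phi x|)}.
  apply: continuous_subspaceT => x.
  by apply: (@continuous_comp _ _ _ phi Num.norm); [exact: cphi|exact: norm_continuous].
have [|c _ hc] := @EVT_max R (fun x => `|phi x|) (- M) M _ cn; first by lra.
exists `|phi c| => // x; have [xM|Mx] := leP `|x| M.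
  by apply: hc; rewrite in_itv/= -ler_norml.
by rewrite phi0// normr0.
Qed.

Lemma compact_supp_integrable phi M : continuous phi -> (forall x, M < `|x| -> phi x = 0) ->
  mu.-integrable setT (EFin \o phi).
Proof.
move=> cphi phi0.
have [B B0 phiB] := compact_supp_bounded cphi phi0.
have -> : EFin \o phi = (EFin \o phi) \_ `[- M, M]%classic.
  apply/funext => x; rewrite patchE; case: ifPn => //.
  rewrite notin_setE/= in_itv/= => /negP.
  by rewrite -ler_norml -ltNge => /phi0 ->.
apply: (iffLR (@integrable_mkcond _ _ R mu `[- M, M]%classic (EFin \o phi) _)) => //.
apply: measurable_bounded_integrable => //.
- by rewrite /= lebesgue_measure_itv/=; case: ifPn => _; rewrite ?ltry// -EFinB ltry.
- by apply: measurable_funTS; exact: continuous_measurable_fun.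
- exists B; split; first exact: num_real.
  by move=> y By x _ /=; rewrite (le_trans (phiB x))// ltW.
Qed.

(** A primitive of phi need not have compact support, but its difference over a step h does. This is
    what makes [psi] admissible in the definition of V. *)
Lemma primitive_difference phi M h : 0 < h -> smooth phi ->
  (forall x, M < `|x| -> phi x = 0) ->
  exists psi, [/\ test_function psi,
    derive1 psi = (fun x => phi (x + h) - phi x) &
    forall x, (`|psi x|%:E <= \int[mu]_(y in `[x, (x + h)%R]%classic) `|phi y|%:E)%E].
Proof.
move=> h0 sphi phi0; have cphi := smooth_continuous sphi.
have iphi := compact_supp_integrable cphi phi0.
have mphi := continuous_measurable_fun cphi.
pose Phi (x : R) := \int[mu]_(t in `]-oo, x]) phi t.
have dPhi (x : R) : is_derive x 1 Phi (phi x).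
  (* The point x + 1 is an arbitrary right end beyond x. *)
  have [] := @continuous_FTC1 R phi -oo%O x (x + 1) _ _ _ (cphi x).
  - by rewrite ltrDl.
  - by apply: integrableS iphi.
  - exact: ltNyr.
  - by move=> d <-; rewrite derive1E; exact: DeriveDef.
pose psi x := Phi (x + h) - Phi x.
have dpsi (x : R) : is_derive x 1 psi (phi (x + h) - phi x).
  by apply: is_deriveB => //; apply: is_derive_addr.
have dpsiE : derive1 psi = (fun x => phi (x + h) - phi x).
  by apply/funext => x; rewrite derive1E derive_val.
have psiE x : psi x = \int[mu]_(t in `]x, x + h]) phi t.
  rewrite /psi /Phi Rintegral_itvB//; last by rewrite bnd_simp lerDl ltW.
  by apply: integrableS iphi.
exists psi; split => //.
  apply/test_functionP; split.
    apply/smoothP; split=> [x|]; first exact: ex_derive.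
    by rewrite dpsiE; exact: smooth_diff.
  (* For |x| > M + h the window from x to x + h misses [-M, M]. *)
  exists (M + h) => x Mx; rewrite psiE.
  rewrite (@eq_Rintegral _ _ _ _ _ (cst 0)) ?Rintegral_cst ?mul0r// => y.
  rewrite inE/= in_itv/= => /andP[xy yh]; apply: phi0.
  move: Mx; rewrite !ltNge; apply: contra; rewrite !ler_norml; lra.
move=> x; rewrite psiE EFin_normr_Rintegral//; last by apply: integrableS iphi.
apply: (le_trans (le_abse_integral _ _ _)) => //.
  by apply/measurable_EFinP; exact: measurable_funTS.
apply: ge0_subset_integral => //.
- by apply/measurable_EFinP; apply: measurable_funTS; exact: measurableT_comp.
- by move=> y /=; rewrite !in_itv/= => /andP[/ltW -> ->].
Qed.

End test_functions.

(** * Duality with test functions *)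

Section step_functions.
Context {R : realType}.
Notation mu := (@lebesgue_measure R).
Lemma integral_step (J : finType) (c : J -> R) (A : J -> set R) (d : R) :
  (forall j, 0 <= c j) -> (forall j, measurable (A j)) -> (forall j, mu (A j) = d%:E) ->
  (\int[mu]_x (\sum_j c j * \1_(A j) x)%:E = (\sum_j c j * d)%:E)%E.
Proof.
move=> c0 mA muA; under eq_integral do rewrite -sumEFin.
rewrite ge0_integral_sum//; last 2 first.
- move=> j; apply/measurable_EFinP; apply: measurable_funM => //.
  by apply: measurable_indic; exact: mA.
- by move=> j x _; rewrite lee_fin mulr_ge0 ?indicE.
rewrite -sumEFin; apply: eq_bigr => j _.
under eq_integral do rewrite EFinM.
rewrite ge0_integralZl_EFin//; last first.
  by apply/measurable_EFinP; apply: measurable_indic; exact: mA.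
by rewrite integral_indic//; [rewrite setIT EFinM -(muA j)|exact: mA].
Qed.

Variable p : R.
Hypothesis p1 : 1 <= p.
Notation q := (hoelder_conjugate p%:E).
Notation N := (Lsup_norm q).

Let p0 : 0 < p. Proof. exact: lt_le_trans p1. Qed.

(** Hoelder against the indicator of [-M, M], whose dual norm is finite. *)
Lemma Lnorm_integrable_itv (g : R -> R) M : measurable_fun setT g ->
  ('N[mu]_(p%:E)[EFin \o g] < +oo)%E -> mu.-integrable `[- M, M]%classic (EFin \o g).
Proof.
move=> mg gfin; pose A := `[- M, M]%classic : set R.
have mA : measurable A by exact: measurable_itv.
have mI : measurable_fun setT (\1_A : R -> R) by exact: measurable_indic.
apply/integrableP; split; first by apply/measurable_EFinP; exact: measurable_funTS.
apply: (@le_lt_trans _ _ (\int[mu]_x `|\1_A x * g x|%:E)%E).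
  rewrite [leLHS]integral_mkcond le_eqVlt; apply/orP; left; apply/eqP.
  apply: eq_integral => x _; rewrite -/A patchE indicE.
  by case: (x \in A); rewrite ?mul1r ?mul0r ?normr0.
apply: (le_lt_trans (hoelder_Lsup_norm p1 mI mg)).
rewrite lte_mul_pinfty ?Lsup_norm_ge0//.
  rewrite ge0_fin_numE ?Lsup_norm_ge0//.
  apply: (@Lsup_norm_lty _ _ p1 _ M 1 mI) => x; rewrite indicE.
    by case: (x \in A) => /=; rewrite ?normr1 ?normr0.
  move=> Mx; rewrite memNset// /A/= in_itv/= => /andP[xM1 xM2].
  by move: Mx; rewrite ltNge ler_norml xM1 xM2.
Qed.

(* The equality case of Hoelder's inequality; for p = 1 this is the sign of m. *)
Definition dual_coef (m : R) : R := Num.sg m * `|m| `^ (p - 1).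

Lemma dual_coefM m : dual_coef m * m = `|m| `^ p.
Proof. by rewrite /dual_coef mulrAC -normrEsg mulr_powRB1. Qed.

(** Conjugacy of the exponents amounts to (p - 1) r = p. *)
Lemma norm_dual_coef m r : 1 < p -> p^-1 + r^-1 = 1 -> `|dual_coef m| `^ r = `|m| `^ p.
Proof.
move=> ltp pr.
have rp : (p - 1) * r = p.
  have -> : p - 1 = p * r^-1.
    by rewrite (_ : r^-1 = 1 - p^-1); [field; rewrite gt_eqF|lra].
  rewrite mulfVK//; apply/eqP => r0; move: pr; rewrite r0 invr0 addr0 => /eqP.
  by rewrite invr_eq1 gt_eqF.
have [->|m0] := eqVneq m 0.
  rewrite /dual_coef sgr0 mul0r normr0 !powR0 ?gt_eqF//.
  by rewrite -(@pmulr_rgt0 _ (p - 1)) ?rp// subr_gt0.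
rewrite /dual_coef normrM normr_sg m0 mul1r ger0_norm ?powR_ge0//.
by rewrite -powRrM rp.
Qed.

(** The sets [A j] are disjoint, so at each point at most one term survives and |phi|^r is at most
    the sum of |m j|^p over the indicators of the [A j]. The exponent 1 - 1/p is 1/r; for p = 1 it
    is 0, the bound is 1 (also for a zero sum, as 0^0 = 1), and the coefficients are signs. *)
Lemma Lsup_norm_step (J : finType) (m : J -> R) (A : J -> set R)
    (theta : J -> R -> R) (d : R) :
  (forall j, measurable_fun setT (theta j)) ->
  (forall j x, 0 <= theta j x <= 1) ->
  (forall j x, ~ A j x -> theta j x = 0) ->
  (forall j, measurable (A j)) -> (forall j, mu (A j) = d%:E) ->
  (forall i j x, A i x -> A j x -> i = j) ->
  (N (fun x => \sum_j dual_coef (m j) * theta j x)%R <=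
     ((\sum_j `|m j| `^ p * d) `^ (1 - p^-1))%:E)%E.
Proof.
move=> mt t01 t0 mA muA disjA.
set phi := fun x => _.
have phiE x : phi x = 0 \/ exists2 j, A j x & phi x = dual_coef (m j) * theta j x.
  have [[j Ajx]|nA] := pselect (exists j, A j x).
    right; exists j => //; rewrite /phi (bigD1 j)//= big1 ?addr0// => i ij.
    by rewrite t0 ?mulr0// => Aix; move: ij; rewrite (disjA _ _ _ Aix Ajx) eqxx.
  by left; rewrite /phi big1// => j _; rewrite t0 ?mulr0// => Ajx; apply: nA; exists j.
have mphi : measurable_fun setT phi.
  by apply: measurable_sum => j; exact: measurable_funM.
(* The sign of d is known only through the measure of some [A j], so an index is needed. *)
have d0 : J -> 0 <= d by move=> j; rewrite -lee_fin -(muA j) measure_ge0.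
have tle j x : `|dual_coef (m j) * theta j x| <= `|dual_coef (m j)|.
  have /andP[h0 h1] := t01 j x.
  by rewrite normrM (ger0_norm h0) ler_piMr.
rewrite /Lsup_norm; case: (hoelder_conjP p1) => [pe1|r ltp ltr pr] /=.
  rewrite pe1 invr1 subrr powRr0; apply: sup_norm_le => x; rewrite lee_fin.
  have [->|[j _ ->]] := phiE x; first by rewrite normr0.
  apply: (le_trans (tle j x)); rewrite /dual_coef pe1 subrr powRr0 mulr1.
  by rewrite normr_sg; case: (m j != 0).
have r0 : 0 < r by exact: lt_trans ltr.
have -> : 1 - p^-1 = r^-1 by rewrite -pr addrC addKr.
rewrite unlock -poweR_EFin; apply: gt0_ler_poweR; rewrite ?invr_ge0 ?(ltW r0)//.
- by rewrite in_itv/= leey andbT; apply: integral_ge0 => x _; rewrite lee_fin powR_ge0.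
- by rewrite in_itv/= leey andbT lee_fin sumr_ge0// => j _; rewrite mulr_ge0 ?powR_ge0 ?d0.
apply: (@le_trans _ _ (\int[mu]_x (\sum_j `|m j| `^ p * \1_(A j) x)%:E)%E).
  apply: ge0_le_integral => //.
  - by move=> x _; rewrite lee_fin powR_ge0.
  - apply/measurable_EFinP; apply: (@measurableT_comp _ _ _ _ _ _ (fun x => x `^ r)%R) => //.
    exact: measurableT_comp.
  - apply/measurable_EFinP; apply: measurable_sum => j; apply: measurable_funM => //.
    by apply: measurable_indic; exact: mA.
  - move=> x _; rewrite lee_fin.
    have s0 (P : pred J) : 0 <= \sum_(j | P j) `|m j| `^ p * \1_(A j) x.
      by apply: sumr_ge0 => j _; rewrite mulr_ge0 ?powR_ge0 ?indicE.
    have [->|[j Ajx ->]] := phiE x; first by rewrite normr0 powR0 ?gt_eqF.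
    apply: (@le_trans _ _ (`|m j| `^ p)).
      rewrite -(norm_dual_coef _ ltp pr).
      by rewrite ge0_ler_powR ?nnegrE ?(ltW r0).
    by rewrite (bigD1 j)//= indicE mem_set// mulr1 lerDl.
rewrite (@integral_step J (fun j => `|m j| `^ p) A d)//.
Qed.

End step_functions.

Section dual_averages.
Context {R : realType}.
Notation mu := (@lebesgue_measure R).

Lemma flat_ring_sum (J : Type) (s : seq J) (F : J -> R -> R) :
  (forall j, flat_ring (F j)) -> flat_ring (fun x => \sum_(j <- s) F j x).
Proof.
move=> hF; elim: s => [|j s IH].
  have -> : (fun x => \sum_(j <- [::]) F j x) = cst 0.
    by apply/funext => x; rewrite big_nil.
  exact: flat_ring_cst.
have -> : (fun x => \sum_(j <- j :: s) F j x) = F j \+ (fun x => \sum_(j <- s) F j x).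
  by apply/funext => x; rewrite big_cons.
exact: flat_ringD.
Qed.

Lemma measurable_bump (c a b : R) : measurable_fun setT (flat_bump c a b).
Proof.
apply: continuous_measurable_fun; apply: smooth_continuous.
exact/flat_ring_smooth/flat_bump_flat_ring.
Qed.

Lemma integral_bumpE (g : R -> R) (c a b : R) : 0 < c ->
  (\int[mu]_x (flat_bump c a b x * g x)%:E =
   \int[mu]_(x in `]a, b[%classic) (flat_bump c a b x * g x)%:E)%E.
Proof.
move=> c0; rewrite [RHS]integral_mkcond; apply: eq_integral => x _.
rewrite patchE mem_setE in_itv/=; case: ifPn => // xab.
by rewrite flat_bump0// mul0r.
Qed.

Lemma integrable_bump (g : R -> R) (c a b : R) : 0 < c ->
  measurable_fun setT g -> mu.-integrable `]a, b[%classic (EFin \o g) ->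
  mu.-integrable setT (fun x => (flat_bump c a b x * g x)%:E).
Proof.
move=> c0 mg ig.
have := iffLR (@integrable_mkcond _ _ R mu `]a, b[%classic (EFin \o g) (measurable_itv _)) ig.
apply: le_integrable => //.
  apply/measurable_EFinP; apply: measurable_funM => //.
  exact: measurable_bump.
move=> x _; rewrite patchE mem_setE in_itv/=; case: ifPn => xab; last first.
  by rewrite flat_bump0// mul0r abse0 normr0.
have /andP[h0 h1] := flat_bump_itv c a b x.
by rewrite lee_fin normrM ler_piMl// ger0_norm.
Qed.

Lemma integral_bump_cvg (g : R -> R) (a b : R) :
  measurable_fun setT g -> mu.-integrable `]a, b[%classic (EFin \o g) ->
  (\int[mu]_x (flat_bump k.+1%:R a b x * g x)%:E @[k --> \oo] -->
   \int[mu]_(x in `]a, b[%classic) (g x)%:E)%E.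
Proof.
move=> mg ig; under eq_fun do rewrite integral_bumpE//.
have mg' : measurable_fun `]a, b[%classic g by exact: measurable_funTS.
have mAb : measurable (`]a, b[%classic : set R) by exact: measurable_itv.
have [] := @dominated_convergence _ _ _ mu `]a, b[%classic mAb
  (fun k x => (flat_bump k.+1%:R a b x * g x)%:E) (EFin \o g) (fun x => `|(g x)%:E|%E).
- move=> k; apply/measurable_EFinP; apply: measurable_funM => //.
  by apply: measurable_funTS; exact: measurable_bump.
- exact/measurable_EFinP.
- apply: aeW => x; rewrite /= in_itv/= => xab.
  apply: cvg_EFin; first exact: nearW.
  rewrite /= -[X in _ --> X]mul1r; apply: cvgMl; exact: flat_bump_cvg.
- exact: integrable_abse.
- apply: aeW => x k _; have /andP[h0 h1] := flat_bump_itv k.+1%:R a b x.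
  by rewrite lee_fin normrM ler_piMl// ger0_norm.
- by [].
Qed.

Variable p : R.
Hypothesis p1 : 1 <= p.
Notation q := (hoelder_conjugate p%:E).
Notation N := (Lsup_norm q).

Let p0 : 0 < p. Proof. exact: lt_le_trans p1. Qed.

(** For S > 0 cancel S^(1 - 1/p), which is legitimate because S is a finite real, and raise S^(1/p)
    <= K to the power p. *)
Lemma le_powR_conj (S K : R) : 0 <= S -> 0 <= K ->
  S <= K * S `^ (1 - p^-1) -> S <= K `^ p.
Proof.
rewrite le_eqVlt => /predU1P[<- _ _|S0 K0 H]; first exact: powR_ge0.
have SS : S = S `^ p^-1 * S `^ (1 - p^-1).
  have Sp : (p^-1 + (1 - p^-1) == 0) ==> (S != 0) by rewrite (gt_eqF S0) implybT.
  by rewrite -(powRD Sp) subrKC powRr1// ltW.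
have SK : S `^ p^-1 <= K by move: H; rewrite {1}SS ler_pM2r// powR_gt0.
have -> : S = (S `^ p^-1) `^ p by rewrite -powRrM mulVf ?gt_eqF// powRr1// ltW.
by rewrite ge0_ler_powR ?nnegrE ?powR_ge0 ?(ltW p0).
Qed.

(** Let S be the left side and test with bumps weighted by [dual_coef] of the averages. As the bumps
    sharpen, the pairing tends to S, while the dual norm stays at most S^(1 - 1/p); [le_powR_conj]
    then solves for S. *)
Lemma dual_averages (g : R -> R) (K : R) (J : finType) (a : J -> R) (d : R) :
  measurable_fun setT g -> ('N[mu]_(p%:E)[EFin \o g] < +oo)%E -> 0 <= K ->
  (forall phi, test_function phi -> (\int[mu]_x (phi x * g x)%:E <= K%:E * N phi)%E) ->
  0 < d ->
  (forall i j x, a i < x < a i + d -> a j < x < a j + d -> i = j) ->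
  \sum_j `|d^-1 * \int[mu]_(x in `]a j, a j + d[) g x| `^ p * d <= K `^ p.
Proof.
move=> mg gfin K0 Hg d0 disj.
set m := fun j => d^-1 * \int[mu]_(x in `]a j, a j + d[) g x.
(* A crude radius, finite because [J] is, such that [-M, M] contains all the intervals. *)
pose M := \sum_j `|a j| + d.
have aM j x : a j < x < a j + d -> `|x| <= M.
  move=> /andP[ax xa].
  have : `|a j| <= \sum_j `|a j| by rewrite (bigD1 j)//= lerDl sumr_ge0.
  have h1 := ler_norm (a j); have := ler_norm (- a j); rewrite normrN => h2 h3.
  by rewrite /M ler_norml; apply/andP; split; lra.
have ig j : mu.-integrable `]a j, a j + d[%classic (EFin \o g).
  apply: integrableS (Lnorm_integrable_itv p1 M mg gfin) => //.
  by move=> x; rewrite /= !in_itv/= -ler_norml => /aM.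
pose th k j : R -> R := flat_bump k.+1%:R (a j) (a j + d).
pose phi k x := \sum_j dual_coef p (m j) * th k j x.
have tphi k : test_function (phi k).
  apply/test_functionP; split.
    apply: flat_ring_smooth; apply: flat_ring_sum => j.
    by apply: flat_ringM; [exact: flat_ring_cst|exact: flat_bump_flat_ring].
  exists M => x Mx; rewrite /phi big1// => j _; rewrite /th flat_bump0 ?mulr0//.
  by apply/negP => /aM; rewrite leNgt Mx.
pose S := \sum_j `|m j| `^ p * d.
have S0 : 0 <= S by apply: sumr_ge0 => j _; rewrite mulr_ge0 ?powR_ge0 ?(ltW d0).
have Nphi k : (N (phi k) <= (S `^ (1 - p^-1))%:E)%E.
  apply: (@Lsup_norm_step _ _ p1 J m (fun j => `]a j, a j + d[%classic) (th k) d).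
  - by move=> j; exact: measurable_bump.
  - by move=> j x; exact: flat_bump_itv.
  - by move=> j x; rewrite /= in_itv/= => /negP xa; rewrite /th flat_bump0.
  - by move=> j; exact: measurable_itv.
  - by move=> j; rewrite lebesgue_measure_itv/= lte_fin ltrDl d0 -EFinB; congr EFin; ring.
  - by move=> i j x; rewrite /= !in_itv/=; exact: disj.
pose u k j := fine (\int[mu]_x (th k j x * g x)%:E)%E.
have uE k j : ((u k j)%:E = \int[mu]_x (th k j x * g x)%:E)%E.
  by rewrite fineK//; apply: integrable_fin_num => //; exact: integrable_bump.
have ucvg j : u k j @[k --> \oo] --> d * m j.
  have -> : d * m j = \int[mu]_(x in `]a j, a j + d[) g x.
    by rewrite /m mulrA divff ?mul1r// gt_eqF.
  apply: fine_cvg; rewrite fineK; first exact: integral_bump_cvg.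
  exact: integrable_fin_num.
have phiE k : (\int[mu]_x (phi k x * g x)%:E = (\sum_j dual_coef p (m j) * u k j)%:E)%E.
  transitivity (\int[mu]_x (\sum_j (dual_coef p (m j))%:E * (th k j x * g x)%:E))%E.
    apply: eq_integral => x _; rewrite /phi mulr_suml -sumEFin.
    by apply: eq_bigr => j _; rewrite -mulrA EFinM.
  have ith j : mu.-integrable setT (fun x => (th k j x * g x)%:E) by exact: integrable_bump.
  rewrite integral_sum//; last by move=> j; exact: integrableZl.
  rewrite -sumEFin; apply: eq_bigr => j _.
  by rewrite integralZl// -uE.
have Hu k : \sum_j dual_coef p (m j) * u k j <= K * S `^ (1 - p^-1).
  rewrite -lee_fin -phiE EFinM; apply: (le_trans (Hg _ (tphi k))).
  by rewrite lee_wpmul2l// lee_fin.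
rewrite -[X in X <= _]/S; apply: le_powR_conj => //.
set W := K * _; have SE : S = \sum_j dual_coef p (m j) * (d * m j).
  by apply: eq_bigr => j _; rewrite mulrCA dual_coefM// mulrC.
have cS : \sum_j dual_coef p (m j) * u k j @[k --> \oo] --> S.
  rewrite SE; apply: cvg_big => [|j _]; first exact: add_continuous.
  by apply: cvgMr; exact: ucvg.
have <- := cvg_lim (@Rhausdorff R) cS.
by apply: limr_le; [apply/cvg_ex; exists S|apply: nearW => k; exact: Hu].
Qed.

End dual_averages.

(** * From averages on a grid to the p-norm *)

Section duality.
Context {R : realType}.
Notation mu := (@lebesgue_measure R).

(** Away from 0 the power is differentiable; at 0 the limit is checked directly, with tolerance
    e^(1/p) for |x|. *)
Lemma continuous_norm_powR (p : R) : 0 < p -> continuous (fun x : R => `|x| `^ p).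
Proof.
move=> p0 l; have nl : `|x| @[x --> l] --> `|l| by exact: norm_continuous.
have [l0|l0] := eqVneq l 0.
  rewrite /continuous_at l0 normr0 powR0 ?gt_eqF//; apply/cvgr0Pnorm_le => e e0.
  have e'0 : 0 < e `^ p^-1 by rewrite powR_gt0.
  move: nl; rewrite l0 normr0 => /cvgr0Pnorm_le/(_ _ e'0).
  apply: filterS => x; rewrite normr_id => h.
  rewrite ger0_norm ?powR_ge0//.
  have -> : e = (e `^ p^-1) `^ p by rewrite -powRrM mulVf ?gt_eqF// powRr1// ltW.
  by rewrite ge0_ler_powR ?nnegrE ?powR_ge0 ?(ltW p0).
have nl0 : 0 < `|l| by rewrite normr_gt0.
apply: (@continuous_cvg _ _ _ _ _ _ (fun x => x `^ p)) => //.
apply: differentiable_continuous; apply/derivable1_diffP.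
by have [] := is_derive1_powR p nl0.
Qed.

Let d (n : nat) : R := n.+1%:R^-1.

Let d_gt0 n : 0 < d n. Proof. by rewrite invr_gt0. Qed.

(* The interval of the grid of mesh 1/(n+1) containing x, without its left
   endpoint. *)
Let cell (x : R) (n : nat) : set R :=
  `](Num.floor (n.+1%:R * x))%:~R * d n, (Num.floor (n.+1%:R * x))%:~R * d n + d n[%classic.

Let cell_near x n :
  (Num.floor (n.+1%:R * x))%:~R * d n <= x <
  (Num.floor (n.+1%:R * x))%:~R * d n + d n.
Proof.
have N0 : (0 : R) < n.+1%:R by rewrite ltr0n.
rewrite /d -[X in _ + X]mul1r -mulrDl ler_pdivrMr// ltr_pdivlMr// (mulrC x).
by rewrite ge_floor -intrD1 floorD1_gt.
Qed.

Let mu_cell x n : mu (cell x n) = (d n)%:E.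
Proof. by rewrite lebesgue_measure_itv/= lte_fin ltrDl d_gt0 -EFinB addrAC subrr add0r. Qed.

Let cell_nicely_shrinking x : nicely_shrinking x (cell x).
Proof.
split; first by move=> n; exact: measurable_itv.
(* The ball of radius [d n] about x contains the cell and is twice as long, whence the ratio 2. *)
exists (2, fun n => PosNum (d_gt0 n)); split => //=.
- exact: cvg_harmonic.
- move=> n y; rewrite /cell /ball/= in_itv/= => /andP[h1 h2].
  have /andP[h3 h4] := cell_near x n.
  by rewrite ltr_norml; apply/andP; split; lra.
- move=> n; rewrite mu_cell lebesgue_measure_ball/=; last exact: ltW.
  by rewrite -EFinM lee_fin mulr_natl.
Qed.

(** Left endpoints of the cells of length 1/(n + 1) that tile [-(n + 1), n + 1[: as n grows, the
    mesh shrinks and the range exhausts the line. *)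
Let a n (i : 'I_(2 * (n.+1 * n.+1))) : R := (i%:R - (n.+1 * n.+1)%:R) * d n.

Let cell_index (x : R) n : `|x| < n.+1%:R -> exists i, @a n i = (Num.floor (n.+1%:R * x))%:~R * d n.
Proof.
move=> xn; set N : nat := n.+1; set k := Num.floor (N%:R * x).
have N0 : (0 : R) < N%:R by rewrite ltr0n.
have [Nx1 Nx2] : - (N * N)%:R <= N%:R * x /\ N%:R * x < (N * N)%:R.
  move: xn; rewrite natrM -mulrN ler_pM2l// ltr_pM2l// ltr_norml.
  by move=> /andP[/ltW -> ->].
have k1 : - (N * N)%:Z <= k by rewrite floor_ge_int rmorphN.
have k2 : k < (N * N)%:Z by rewrite floor_lt_int.
have [i ik] : exists i : nat, k + (N * N)%:Z = i.
  have : 0 <= k + (N * N)%:Z by rewrite -lerBlDr sub0r.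
  by case: (k + _) => // i _; exists i.
have iN : (i < 2 * (N * N))%N.
  by rewrite -ltz_nat -ik mul2n -addnn PoszD ltrD2r.
exists (Ordinal iN); rewrite /a/= -[i%:R]/((i : int)%:~R) -ik intrD addrK.
by [].
Qed.

Variable p : R.
Hypothesis p1 : 1 <= p.
Notation q := (hoelder_conjugate p%:E).
Notation N := (Lsup_norm q).

Let p0 : 0 < p. Proof. exact: lt_le_trans p1. Qed.

(* By [dual_averages] the p-norms of the averages of g over a finite grid are at
   most K; refining the grid, they converge almost everywhere to g by Lebesgue
   differentiation, and Fatou's lemma concludes. *)
Lemma Lnorm_le_dual (g : R -> R) (K : R) :
  measurable_fun setT g -> ('N[mu]_(p%:E)[EFin \o g] < +oo)%E -> 0 <= K ->
  (forall phi, test_function phi -> (\int[mu]_x (phi x * g x)%:E <= K%:E * N phi)%E) ->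
  ('N[mu]_(p%:E)[EFin \o g] <= K%:E)%E.
Proof.
move=> mg gfin K0 Hg.
pose m n i := (d n)^-1 * \int[mu]_(x in `]@a n i, a i + d n[) g x.
(* The averages use open cells, as [dual_averages] does; half-open ones here put every point of the
   range in exactly one cell. *)
pose G n x := (\sum_i `|m n i| `^ p * \1_(`[@a n i, a i + d n[%classic) x)%:E.
have mG n : measurable_fun setT (G n).
  apply/measurable_EFinP; apply: measurable_sum => i; exact: measurable_funM.
have G0 n x : (0 <= G n x)%E.
  by rewrite lee_fin sumr_ge0// => i _; rewrite mulr_ge0 ?powR_ge0 ?indicE.
have aE n (i j : 'I_(2 * (n.+1 * n.+1))) x :
    a i <= x < a i + d n -> a j <= x < a j + d n -> i = j.
  have aS (u : 'I_(2 * (n.+1 * n.+1))) : a u + d n = (u%:R + 1 - (n.+1 * n.+1)%:R) * d n.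
    by rewrite /a; ring.
  rewrite !aS /a => /andP[h1 h2] /andP[h3 h4].
  have := le_lt_trans h1 h4; have := le_lt_trans h3 h2.
  rewrite !ltr_pM2r ?d_gt0// !ltrD2r !natr1 !ltr_nat !ltnS => ji ij.
  by apply/val_inj/eqP; rewrite eqn_leq ij ji.
have intG n : (\int[mu]_x G n x <= (K `^ p)%:E)%E.
  rewrite (@integral_step _ _ (fun i => `|m n i| `^ p) _ (d n)); last 3 first.
  - by move=> i; exact: powR_ge0.
  - by move=> i; exact: measurable_itv.
  - by move=> i; rewrite lebesgue_measure_itv/= lte_fin ltrDl d_gt0 -EFinB addrAC subrr add0r.
  rewrite lee_fin; apply: (dual_averages p1 mg gfin K0 Hg (d_gt0 n)).
  move=> i j x /andP[h1 h2] /andP[h3 h4]; apply: (aE n i j x).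
    by rewrite (ltW h1).
  by rewrite (ltW h3).
have locg : locally_integrable setT g.
  split => // [|C _ cC]; first exact: openT.
  have [M [_ HM]] := compact_bounded cC.
  have /integrableP[_] := Lnorm_integrable_itv p1 (M + 1) mg gfin.
  apply: le_lt_trans; apply: ge0_subset_integral => //.
  - exact: compact_measurable.
  - by apply/measurable_EFinP; apply: measurable_funTS; exact: measurableT_comp.
  - move=> x Cx; rewrite /= in_itv/= -ler_norml.
    by apply: (HM (M + 1)); rewrite ?ltrDl.
have Gcvg : {ae mu, forall x, limn_einf (G ^~ x) = (`|g x| `^ p)%:E}.
  have := lebesgue_differentiation locg.
  apply: filterS; first exact: (ae_filter_ringOfSetsType mu).
  move=> x lx.
  have := nice_lebesgue_differentiation cell_nicely_shrinking locg lx.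
  pose w n := (d n)^-1 * \int[mu]_(y in cell x n) g y.
  have ic n : mu.-integrable (cell x n) (EFin \o g).
    pose M := `|x| + d n.
    apply: integrableS (Lnorm_integrable_itv p1 M mg gfin); rewrite /cell//.
    move=> y; rewrite /= !in_itv/= => /andP[h1 h2].
    have /andP[h3 h4] := cell_near x n.
    have := ler_norm x; have := ler_norm (- x); rewrite normrN /M => h5 h6.
    by apply/andP; split; lra.
  have wE n : ((mu (cell x n))^-1 * \int[mu]_(y in cell x n) (g y)%:E = (w n)%:E)%E.
    rewrite mu_cell inver gt_eqF// /w EFinM fineK//.
    by apply: integrable_fin_num (ic n); exact: measurable_itv.
  under eq_fun do rewrite wE.
  move=> /fine_cvg/= wg.
  (* Once n + 1 > |x|, the point x lies in the grid, and only the term of its own cell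
     contributes. *)
  have Gw : \forall n \near \oo, (`|w n| `^ p)%:E = G n x.
    near=> n.
    have xn : `|x| < n.+1%:R.
      by near: n; apply: filterS (nbhs_infty_gtr `|x|) => n /lt_le_trans; apply; rewrite ler_nat.
    have [i ai] := cell_index xn.
    have xi : a i <= x < a i + d n by rewrite ai cell_near.
    rewrite /G (bigD1 i)//= big1 => [|j ji]; last first.
      rewrite indicE memNset ?mulr0//= in_itv/= => xj.
      by move: ji; rewrite (aE _ _ _ _ xj xi) eqxx.
    rewrite addr0 indicE mem_set/= ?in_itv//= mulr1.
    by rewrite /w /m ai /cell.
  have cG : G n x @[n --> \oo] --> (`|g x| `^ p)%:E.
    apply: cvg_trans (near_eq_cvg Gw) _.
    apply: cvg_EFin; first exact: nearW.
    exact: (continuous_cvg _ (@continuous_norm_powR _ p0 _)).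
  by have [-> _] := cvg_limn_einf_sup cG.
have G_einf0 x : (0 <= limn_einf (G ^~ x))%E.
  rewrite limn_einf_lim; apply: lime_ge; first exact: is_cvg_einfs.
  apply: nearW => n; apply: le_ereal_inf_tmp => _ [k _ <-]; exact: G0.
have mGinf : measurable_fun setT (fun x => limn_einf (G ^~ x)).
  (* Measurability is obtained through the upper limit of the negated sequence. *)
  have -> : (fun x => limn_einf (G ^~ x)) = (fun x => - limn_esup (fun n => - G n x))%E.
    apply/funext => x; rewrite -(limn_einfN (fun n => - G n x)%E); congr limn_einf.
    by apply/funext => n; rewrite /= ?oppeK ?opprK.
  apply: measurableT_comp => //; apply: measurable_fun_limn_esup => n.
  exact: measurableT_comp.
have fat : (\int[mu]_x limn_einf (G ^~ x) <= (K `^ p)%:E)%E.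
  apply: le_trans (fatou mu measurableT mG (fun n x _ => G0 n x)) _.
  rewrite limn_einf_lim; apply: lime_le; first exact: is_cvg_einfs.
  apply: nearW => n; apply: le_trans (intG n); apply: ereal_inf_lbound.
  by exists n => /=.
have H : (\int[mu]_x (`|g x| `^ p)%:E <= (K `^ p)%:E)%E.
  apply: le_trans fat; apply: ae_ge0_le_integral => //.
  - apply/measurable_EFinP; apply: (@measurableT_comp _ _ _ _ _ _ (fun x => x `^ p)%R) => //.
    exact: measurableT_comp.
  - move: Gcvg; apply: filterS; first exact: (ae_filter_ringOfSetsType mu).
    by move=> x ->.
rewrite unlock.
have -> : K%:E = ((K `^ p)%:E `^ p^-1)%E.
  by rewrite poweR_EFin -powRrM divff ?gt_eqF// powRr1.
apply: gt0_ler_poweR => //.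
- by rewrite invr_ge0 ltW.
- by rewrite in_itv/= leey andbT; apply: integral_ge0 => x _; rewrite lee_fin powR_ge0.
- by rewrite in_itv/= leey andbT lee_fin powR_ge0.
Unshelve. all: by end_near. Qed.

End duality.

(** * The lower bound *)

Section lower_bound.
Context {R : realType}.
Notation mu := (@lebesgue_measure R).
Variable p : R.
Hypothesis p1 : 1 <= p.
Notation q := (hoelder_conjugate p%:E).
Notation N := (Lsup_norm q).
Notation Np f := ('N[mu]_(p%:E)[EFin \o f])%E.
Implicit Types f g phi : R -> R.
Local Open Scope ereal_scope.

Lemma integrable_pairing phi g : measurable_fun setT phi -> measurable_fun setT g ->
  N phi < +oo -> Np g < +oo -> mu.-integrable setT (fun x => (phi x * g x)%:E).
Proof.
move=> mphi mg phifin gfin; apply/integrableP; split.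
  by apply/measurable_EFinP; exact: measurable_funM.
apply: (le_lt_trans (hoelder_Lsup_norm p1 mphi mg)).
by rewrite lte_mul_pinfty ?Lsup_norm_ge0// ge0_fin_numE// Lsup_norm_ge0.
Qed.

Lemma abse_integral_pairing_le phi g : measurable_fun setT phi -> measurable_fun setT g ->
  `|\int[mu]_x (phi x * g x)%:E| <= N phi * Np g.
Proof.
move=> mphi mg; apply: le_trans (hoelder_Lsup_norm p1 mphi mg).
apply: (le_abse_integral mu) => //.
by apply/measurable_EFinP; exact: measurable_funM.
Qed.

Lemma measurable_shift_by (h : R) f : measurable_fun setT f -> measurable_fun setT (shift_by h f).
Proof. by move=> mf; exact: (measurableT_comp mf (measurable_addr (- h))). Qed.

Lemma Lnorm_shift_by_lty (h : R) f : measurable_fun setT f -> Np f < +oo ->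
  Np (shift_by h f \- f)%R < +oo.
Proof.
move=> mf ffin; have mh := measurable_shift_by h mf.
have mNf : measurable_fun setT (\- f)%R by exact: measurableT_comp.
apply: (le_lt_trans (minkowski_EFin mu mh mNf p1)).
rewrite lte_add_pinfty//; first by rewrite (Lnorm_addr (- h) p mf).
by have := oppe_Lnorm mu (EFin \o f) p%:E => /= ->.
Qed.

(** Evaluating f_h - f at x + h gives f(x) - f(x + h), the negative of f_(-h) - f at x. *)
Lemma Lnorm_shift_byN (h : R) f : measurable_fun setT f ->
  Np (shift_by (- h) f \- f)%R = Np (shift_by h f \- f)%R.
Proof.
move=> mf; have mh := measurable_shift_by h mf.
rewrite -(Lnorm_addr h p (measurable_funB mh mf)) -[LHS]oppe_Lnorm.
apply: eq_Lnorm => x; rewrite /= /shift_by opprK addrK.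
by rewrite opprB.
Qed.

(** Discrete integration by parts: a change of variables moves the translation from phi to f. The
    finite norms make each product integrable, so that the integrals may be split. *)
Lemma integral_translation_difference phi f (h : R) :
  measurable_fun setT phi -> measurable_fun setT f -> N phi < +oo -> Np f < +oo ->
  \int[mu]_x ((phi (x + h) - phi x) * f x)%:E =
  \int[mu]_x (phi x * (shift_by h f \- f)%R x)%:E.
Proof.
move=> mphi mf phifin ffin.
have mh := measurable_shift_by h mf.
have mphih := measurableT_comp mphi (measurable_addr h).
have fhfin : Np (shift_by h f) < +oo by rewrite (Lnorm_addr (- h) p mf).
have phihfin : N (fun x => phi (x + h)%R) < +oo by rewrite Lsup_norm_addr.
under eq_integral do rewrite mulrBl EFinB.
rewrite integralB//; last 2 first.
- exact: (integrable_pairing mphih mf).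
- exact: integrable_pairing.
under [RHS]eq_integral do rewrite mulrBr EFinB.
rewrite integralB//; last 2 first.
- exact: integrable_pairing.
- exact: integrable_pairing.
congr (_ - _).
rewrite -[RHS](integral_addr h); last by apply/measurable_EFinP; exact: measurable_funM.
by apply: eq_integral => x _; rewrite /shift_by addrK.
Qed.

Lemma test_functionE phi : test_function phi ->
  [/\ smooth phi, measurable_fun setT phi, N phi < +oo,
      measurable_fun setT (derive1 phi) & N (derive1 phi) < +oo].
Proof.
move=> /test_functionP[sphi [M phi0]].
have cphi := smooth_continuous sphi.
have cphi' := smooth_continuous (smooth_derive1 sphi).
have phi'0 := derive1_supp phi0.
have [B _ phiB] := compact_supp_bounded cphi phi0.
have [B' _ phi'B] := compact_supp_bounded cphi' phi'0.
have mphi := continuous_measurable_fun cphi.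
have mphi' := continuous_measurable_fun cphi'.
by split => //; [exact: Lsup_norm_lty phiB phi0|exact: Lsup_norm_lty phi'B phi'0].
Qed.

Variables (alpha C : R) (f : R -> R).
Hypothesis alpha0 : (0 < alpha)%R.
Hypothesis alpha1 : (alpha <= 1)%R.
Hypothesis mf : measurable_fun setT f.
Hypothesis ffin : Np f < +oo.
Hypothesis C0 : (0 <= C)%R.
Hypothesis HC : forall phi, test_function phi ->
  \int[mu]_x (derive1 phi x * f x)%:E
    <= C%:E * N phi `^ alpha * N (derive1 phi) `^ (1 - alpha).

Let Lnorm_shift_by_le_pos (h : R) : (0 < h)%R ->
  Np (shift_by h f \- f)%R <= (2 `^ (1 - alpha) * C * h `^ alpha)%:E.
Proof.
move=> h0.
apply: Lnorm_le_dual => //.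
- by apply: measurable_funB => //; exact: measurable_shift_by.
- exact: Lnorm_shift_by_lty.
- by rewrite !mulr_ge0 ?powR_ge0.
move=> phi tphi; have [sphi mphi phifin _ _] := test_functionE tphi.
have [_ [M phi0]] := iffLR (test_functionP phi) tphi.
rewrite -integral_translation_difference//.
have [psi [tpsi dpsi psi_le]] := primitive_difference h0 sphi phi0.
have [_ mpsi psifin mpsi' psi'fin] := test_functionE tpsi.
have := HC tpsi; rewrite dpsi => /le_trans; apply.
have Npsi : N psi <= h%:E * N phi by exact: Lsup_norm_average.
have Npsi' : N (fun x => phi (x + h) - phi x)%R <= 2%:E * N phi.
  have := Lsup_normB p1 (measurableT_comp mphi (measurable_addr h)) mphi.
  by rewrite (Lsup_norm_addr p1 h mphi) mule_natl mule2n.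
move: Npsi Npsi' psifin psi'fin phifin; rewrite dpsi.
(* The three norms are finite and nonnegative, so the remaining inequality is one between real
   numbers. *)
have := Lsup_norm_ge0 p phi; have := Lsup_norm_ge0 p psi.
have := Lsup_norm_ge0 p (fun x => phi (x + h) - phi x)%R.
case: (N phi) => [n||]//; case: (N psi) => [u||]//.
case: (N (fun x => phi (x + h) - phi x)%R) => [v||]//.
rewrite !lee_fin => v0 u0 n0 uh v2 _ _ _.
have -> : (2 `^ (1 - alpha) * C * h `^ alpha * n =
    C * (h * n) `^ alpha * (2 * n) `^ (1 - alpha))%R.
  rewrite !powRM// ?ltW//.
  have nE : (n = n `^ alpha * n `^ (1 - alpha))%R.
    by rewrite -powRD ?subrKC ?powRr1// oner_eq0.
  by rewrite {1}nE; ring.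
apply: ler_pM; rewrite ?mulr_ge0 ?powR_ge0//.
  by rewrite ler_wpM2l// ge0_ler_powR ?nnegrE ?(ltW alpha0)// mulr_ge0// ltW.
by rewrite ge0_ler_powR ?nnegrE ?subr_ge0// mulr_ge0.
Qed.

Lemma Lnorm_shift_by_le (h : R) : h != 0%R ->
  Np (shift_by h f \- f)%R <= (2 `^ (1 - alpha) * C * `|h| `^ alpha)%:E.
Proof.
rewrite neq_lt => /orP[h0|h0]; last by rewrite gtr0_norm// Lnorm_shift_by_le_pos.
by rewrite ltr0_norm// -Lnorm_shift_byN// Lnorm_shift_by_le_pos// oppr_gt0.
Qed.

End lower_bound.

(** * The upper bound *)

Section upper_bound.
Context {R : realType}.
Notation mu := (@lebesgue_measure R).

(** The absolute value makes integrand and primitive continuous on the whole line; the derivative is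
    then needed only on the open interval, away from 0. *)
Lemma integral_powR (alpha t : R) : 0 < alpha -> 0 < t ->
  (\int[mu]_(r in `[0%R, t]%classic) (`|r| `^ alpha)%:E = (t `^ (alpha + 1) / (alpha + 1))%:E)%E.
Proof.
move=> a0 t0; have a10 : 0 < alpha + 1 by rewrite addr_gt0.
pose F (x : R) := `|x| `^ (alpha + 1) / (alpha + 1).
have cF : continuous F by move=> x; apply: cvgMl; exact: continuous_norm_powR.
have dF (x : R) : 0 < x -> is_derive x 1 F (`|x| `^ alpha).
  move=> x0; apply: (@near_eq_is_derive _ _ _ (fun y => y `^ (alpha + 1) * (alpha + 1)^-1)).
    near=> y; rewrite /F ger0_norm//; apply: ltW; near: y; exact: lt_nbhsr.
  apply: is_derive_eq (is_deriveM (is_derive1_powR (alpha + 1) x0)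
    (is_derive_cst ((alpha + 1)^-1) x 1)) _.
  rewrite /GRing.scale/= mulr0 add0r addrK gtr0_norm//.
  by rewrite mulrA mulVf ?mul1r// gt_eqF.
rewrite (@continuous_FTC2 _ _ F)//.
- by rewrite -EFinB /F normr0 powR0 ?gt_eqF// mul0r subr0 gtr0_norm.
- by apply: continuous_subspaceT; exact: continuous_norm_powR.
- split.
  + by move=> x; rewrite in_itv/= => /andP[x0 _]; have [] := dF _ x0.
  + by apply: cvg_at_right_filter; exact: cF.
  + by apply: cvg_at_left_filter; exact: cF.
- move=> x; rewrite in_itv/= => /andP[x0 _].
  by rewrite derive1E; have := dF _ x0 => ?; rewrite derive_val.
Unshelve. all: by end_near. Qed.

(* Take t = a / b; if a = 0, replace a by e > 0 and let e tend to 0. *)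
Lemma optimize_scale (alpha G s a b : R) : 0 < alpha -> alpha <= 1 ->
  0 <= s -> 0 <= a -> 0 < b ->
  (forall t, 0 < t -> t * G <= a * s * t `^ alpha + b * s * (t `^ (alpha + 1) / (alpha + 1))) ->
  G <= ((1 + alpha)^-1 + 1) * s * a `^ alpha * b `^ (1 - alpha).
Proof.
move=> al0 al1 s0; wlog a_gt0 : a / 0 < a.
  move=> W a0 b0 H; have [a1|] := ltP 0 a; first exact: W.
  move=> a1; have {a0 a1} a0 : a = 0 by apply/eqP; rewrite eq_le a1 a0.
  rewrite a0 powR0 ?gt_eqF// mulr0 mul0r.
  set B := ((1 + alpha)^-1 + 1) * s * b `^ (1 - alpha).
  have B0 : 0 <= B by rewrite !mulr_ge0 ?powR_ge0// addr_ge0// invr_ge0 addr_ge0// ltW.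
  have GB eta : 0 < eta -> G <= B * eta.
    move=> eta0; pose e := eta `^ alpha^-1.
    have e0 : 0 < e by rewrite powR_gt0.
    have -> : eta = e `^ alpha by rewrite -powRrM mulVf ?gt_eqF// powRr1// ltW.
    rewrite /B mulrAC; apply: W => //; first exact: ltW.
    move=> t t0; apply: (le_trans (H t t0)); rewrite lerD2r a0 !mul0r.
    by rewrite !mulr_ge0 ?powR_ge0// ltW.
  rewrite leNgt; apply/negP => G0.
  (* As B / (2 (B + 1)) < 1, this choice of eta gives B eta < G, a contradiction. *)
  have := GB (G / (2 * (B + 1))) _; rewrite divr_gt0 ?mulr_gt0 ?ltr_wpDl//.
  move=> /(_ isT); rewrite mulrCA; apply/negP; rewrite -ltNge gtr_pMr//.
  by rewrite ltr_pdivrMr ?mulr_gt0 ?ltr_wpDl//; lra.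
move=> _ b0 H; have t0 := divr_gt0 a_gt0 b0.
have {H} := H _ t0; set t := a / b; set T := t `^ alpha.
have -> : t `^ (alpha + 1) = T * t.
  by rewrite powRD ?powRr1// ?(ltW t0)// gt_eqF// addr_gt0.
have Tb : T * b = a `^ alpha * b `^ (1 - alpha).
  have bE : b = b `^ alpha * b `^ (1 - alpha).
    by rewrite -powRD ?subrKC ?powRr1 ?(ltW b0)// oner_eq0.
  rewrite {1}bE mulrA -powRM ?(ltW t0) ?(ltW b0)//.
  by rewrite /t divfK ?gt_eqF.
have tb : b * t = a by rewrite /t mulrC divfK// gt_eqF.
rewrite -(mulrA _ (a `^ alpha)) -Tb.
(* Since b t = a, the two terms are t s T b times 1 and times 1 / (1 + alpha): this is the origin of
   the constant. *)
have -> : a * s * T + b * s * (T * t / (alpha + 1)) =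
    t * (((1 + alpha)^-1 + 1) * s * (T * b)).
  rewrite -tb (addrC 1); field; rewrite gt_eqF// addr_gt0//.
by rewrite ler_pM2l.
Qed.

Variable p : R.
Hypothesis p1 : 1 <= p.
Notation q := (hoelder_conjugate p%:E).
Notation N := (Lsup_norm q).
Notation Np f := ('N[mu]_(p%:E)[EFin \o f])%E.
Variables (alpha s : R) (f : R -> R).
Hypothesis alpha0 : 0 < alpha.
Hypothesis alpha1 : alpha <= 1.
Hypothesis mf : measurable_fun setT f.
Hypothesis ffin : (Np f < +oo)%E.
Hypothesis s0 : 0 <= s.
Hypothesis Hs : forall h : R, (Np (shift_by h f \- f)%R <= (s * `|h| `^ alpha)%:E)%E.
Variable phi : R -> R.
Hypothesis tphi : test_function phi.

Let integrable_G (h : R) : mu.-integrable setT (fun x => (derive1 phi (x + h) * f x)%:E).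
Proof.
have [_ _ _ mphi' phi'fin] := test_functionE p1 tphi.
apply: (integrable_pairing p1 (phi := fun x => derive1 phi (x + h))) => //.
- exact: (measurableT_comp mphi' (measurable_addr h)).
- by rewrite Lsup_norm_addr.
Qed.

Section pairing_with_translates.
Variable G : R -> R.
Hypothesis GE : forall h, (G h)%:E = (\int[mu]_x (derive1 phi (x + h) * f x)%:E)%E.

(** G(h) - G(0) is the pairing of phi' with f_h - f, to which Hoelder applies. *)
Let G_oscillation (h : R) : (((G 0 - G h)%R)%:E <= N (derive1 phi) * (s * `|h| `^ alpha)%:E)%E.
Proof.
have [_ _ _ mphi' phi'fin] := test_functionE p1 tphi.
have mh := measurable_shift_by h mf.
apply: (@le_trans _ _ `|(G h - G 0)%R%:E|%E).
  by rewrite lee_fin distrC ler_norm.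
have -> : ((G h - G 0)%R%:E = \int[mu]_x (derive1 phi x * (shift_by h f \- f)%R x)%:E)%E.
  rewrite -(integral_translation_difference p1)//.
  under [RHS]eq_integral do rewrite mulrBl EFinB.
  rewrite EFinB integralB//; last first.
    by have := integrable_G 0; under eq_fun do rewrite addr0.
  congr (_ - _)%E; first exact: GE.
  by apply: etrans (GE 0) _; apply: eq_integral => x _; rewrite addr0.
apply: (le_trans (abse_integral_pairing_le p1 mphi' (measurable_funB mh mf))).
by rewrite lee_wpmul2l// Lsup_norm_ge0.
Qed.

(** Here [z.1] is the translation and [z.2] the space variable; truncating to [0, t] makes the
    function integrable on the plane, so that Fubini applies. *)
Let kernel (t : R) (z : R * R) : R :=
  if 0 <= z.1 <= t then derive1 phi (z.2 + z.1) * f z.2 else 0.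

Let measurable_kernel t : measurable_fun setT (kernel t).
Proof.
have [_ _ _ mphi' _] := test_functionE p1 tphi.
apply: measurable_fun_ifT => //.
  by apply: measurable_and; apply: measurable_fun_ler.
apply: measurable_funM; last exact: measurableT_comp.
by apply: measurableT_comp => //; exact: measurable_funD.
Qed.

(** By Hoelder the integral of |kernel| over x is bounded uniformly in the translation, which ranges
    over an interval of finite length. *)
Let integrable_kernel t : 0 < t -> (mu \x mu)%E.-integrable setT (EFin \o kernel t).
Proof.
move=> t0; have [_ _ _ mphi' phi'fin] := test_functionE p1 tphi.
have mk : measurable_fun setT (EFin \o kernel t) by exact/measurable_EFinP.
apply: (iffRL (@integrable12ltyP _ _ _ _ _ mu mu _ mk)).
pose B := (N (derive1 phi) * Np f)%E.
have B0 : (0 <= B)%E by rewrite mule_ge0 ?Lsup_norm_ge0 ?Lnorm_ge0.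
have Bfin : (B < +oo)%E.
  by rewrite lte_mul_pinfty ?Lsup_norm_ge0// ge0_fin_numE// Lsup_norm_ge0.
apply: (@le_lt_trans _ _ (\int[mu]_(h in `[0%R, t]%classic) B)%E).
  rewrite [leRHS]integral_mkcond; apply: ge0_le_integral => //.
  - by move=> h _; apply: integral_ge0.
  - have mak : measurable_fun setT (abse \o (EFin \o kernel t)) by exact: measurableT_comp.
    exact: (@measurable_fun_fubini_tonelli_F _ _ _ _ _ mu _ mak (fun z => abse_ge0 _)).
  - by apply/(measurable_restrictT _ _).1 => //; exact: measurable_cst.
  - move=> h _; rewrite patchE mem_setE in_itv/= /kernel/=.
    case: ifPn => ht; last by under eq_integral do rewrite normr0; rewrite integral0.
    have := hoelder_Lsup_norm p1 (measurableT_comp mphi' (measurable_addr h)) mf.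
    by rewrite (Lsup_norm_addr p1 h mphi').
rewrite integral_cst//= lebesgue_measure_itv/= lte_fin t0 -EFinB.
by rewrite lte_mul_pinfty ?ltry// ge0_fin_numE.
Qed.

(** For fixed x the integrand is the derivative of phi(x + h) f(x) with respect to h. *)
Let integral_kernel t : 0 < t ->
  (\int[mu]_x \int[mu]_h (kernel t (h, x))%:E = \int[mu]_x ((phi (x + t) - phi x) * f x)%:E)%E.
Proof.
move=> t0; have [sphi _ _ _ _] := test_functionE p1 tphi.
apply: eq_integral => x _.
transitivity (\int[mu]_(h in `[0%R, t]%classic) (derive1 phi (x + h) * f x)%:E)%E.
  rewrite [RHS]integral_mkcond; apply: eq_integral => h _.
  by rewrite patchE mem_setE in_itv/= /kernel/=; case: ifP.
pose F h := phi (x + h) * f x.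
have dF (h : R) : is_derive h 1 F (derive1 phi (x + h) * f x).
  have dp : is_derive h 1 (fun h => phi (x + h)) (derive1 phi (x + h)).
    under eq_fun do rewrite addrC; rewrite addrC; apply: is_derive_addr.
    exact: smooth_is_derive.
  apply: is_derive_eq (is_deriveM dp (is_derive_cst (f x) h 1)) _.
  by rewrite /GRing.scale/= mulr0 add0r mulrC.
have cF : continuous F.
  by move=> h; apply: differentiable_continuous; apply/derivable1_diffP; have [] := dF h.
rewrite (@continuous_FTC2 _ _ F)//.
- by rewrite -EFinB /F addr0 mulrBl.
- apply: continuous_subspaceT => h; apply: cvgMl.
  apply: (@continuous_comp _ _ _ (fun h => x + h) (derive1 phi)).
    by apply: cvgD; [exact: cvg_cst|exact: cvg_id].
  exact/smooth_continuous/smooth_derive1.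
- split.
  + by move=> h _; have [] := dF h.
  + by apply: cvg_at_right_filter; exact: cF.
  + by apply: cvg_at_left_filter; exact: cF.
- by move=> h _; rewrite derive1E; have := dF h => ?; rewrite derive_val.
Qed.

Let integral_kernelE t h :
  (\int[mu]_x (kernel t (h, x))%:E = ((fun h => (G h)%:E) \_ `[0%R, t]%classic) h)%E.
Proof.
rewrite patchE mem_setE in_itv/= /kernel/=; case: ifPn => ht; first by rewrite GE.
by rewrite integral0.
Qed.

Lemma scale_bound (t : R) : 0 < t ->
  t * G 0 <= fine (N phi) * s * t `^ alpha +
    fine (N (derive1 phi)) * s * (t `^ (alpha + 1) / (alpha + 1)).
Proof.
move=> t0; have [sphi mphi phifin mphi' phi'fin] := test_functionE p1 tphi.
(* Fubini supplies the integrability of G as well. *)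
have iG : mu.-integrable `[0%R, t]%classic (fun h => (G h)%:E).
  apply: (iffRL (@integrable_mkcond _ _ R mu `[0%R, t]%classic _ _)) => //.
  have := integrable_fubini_F (integrable_kernel t0).
  by rewrite /fubini_F; under eq_fun do rewrite integral_kernelE.
have upper : (\int[mu]_(h in `[0%R, t]%classic) (G h)%:E <= (fine (N phi) * s * t `^ alpha)%:E)%E.
  rewrite [leLHS]integral_mkcond; under eq_integral do rewrite -integral_kernelE.
  have /= -> := Fubini (integrable_kernel t0).
  rewrite integral_kernel// (integral_translation_difference p1)//.
  apply: le_trans (lee_abs _) _.
  have mg := measurable_funB (measurable_shift_by t mf) mf.
  apply: (le_trans (abse_integral_pairing_le p1 mphi mg)).
  rewrite -mulrA EFinM fineK ?ge0_fin_numE ?Lsup_norm_ge0// lee_wpmul2l ?Lsup_norm_ge0//.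
  by have := Hs t; rewrite gtr0_norm.
pose b := fine (N (derive1 phi)).
have bE : b%:E = N (derive1 phi) by rewrite fineK// ge0_fin_numE ?Lsup_norm_ge0.
have ipow : mu.-integrable `[0%R, t]%classic (fun h => (`|h| `^ alpha)%:E).
  apply: continuous_compact_integrable; first exact: segment_compact.
  by apply: continuous_subspaceT; exact: continuous_norm_powR.
have lower : ((t * G 0 - b * s * (t `^ (alpha + 1) / (alpha + 1)))%:E <=
    \int[mu]_(h in `[0%R, t]%classic) (G h)%:E)%E.
  have icst : mu.-integrable `[0%R, t]%classic (fun h => (G 0)%:E).
    by apply: continuous_compact_integrable; [exact: segment_compact|exact: cst_continuous].
  rewrite (_ : (t * G 0 - _)%:E =
    (\int[mu]_(h in `[0%R, t]%classic) ((G 0)%:E - (b * s)%:E * (`|h| `^ alpha)%:E))%E).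
    apply: le_integral => //.
      apply: integrableB => //; exact: integrableZl.
    move=> h _; have := G_oscillation h; rewrite -bE -EFinM !lee_fin => H.
    by move: H; rewrite mulrA; lra.
  rewrite integralB//; last exact: integrableZl.
  rewrite integralZl// integral_powR// integral_cst//= lebesgue_measure_itv/= lte_fin t0.
  by rewrite -EFinD subr0 (mulrC t).
have := le_trans lower upper; rewrite lee_fin -/b; lra.
Qed.

End pairing_with_translates.

Lemma integral_derive1_le :
  (\int[mu]_x (derive1 phi x * f x)%:E <=
   (((1 + alpha)^-1 + 1) * s)%:E * N phi `^ alpha * N (derive1 phi) `^ (1 - alpha))%E.
Proof.
have [_ mphi phifin mphi' phi'fin] := test_functionE p1 tphi.
have aE : (fine (N phi))%:E = N phi by rewrite fineK// ge0_fin_numE ?Lsup_norm_ge0.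
have bE : (fine (N (derive1 phi)))%:E = N (derive1 phi).
  by rewrite fineK// ge0_fin_numE ?Lsup_norm_ge0.
have [G GE] : exists G : R -> R,
    forall h, (G h)%:E = (\int[mu]_x (derive1 phi (x + h) * f x)%:E)%E.
  exists (fun h => \int[mu]_x (derive1 phi (x + h) * f x)) => h.
  by rewrite fineK//; apply: integrable_fin_num => //; exact: integrable_G.
have G0E : (\int[mu]_x (derive1 phi x * f x)%:E = (G 0)%:E)%E.
  by rewrite GE; under [RHS]eq_integral do rewrite addr0.
(* The choice of scale divides by N(phi'). If this norm is 0, the pairing vanishes by Hoelder. *)
have [b0|b0] := eqVneq (N (derive1 phi)) 0%E.
  apply: (@le_trans _ _ 0%E).
    apply: le_trans (lee_abs _) _.
    by apply: (le_trans (abse_integral_pairing_le p1 mphi' mf)); rewrite b0 mul0e.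
  by rewrite !mule_ge0 ?poweR_ge0// lee_fin mulr_ge0// addr_ge0// invr_ge0 addr_ge0// ltW.
rewrite G0E -aE -bE !poweR_EFin -!EFinM lee_fin.
apply: optimize_scale => //; last exact: scale_bound.
- by rewrite fine_ge0 ?Lsup_norm_ge0.
- by rewrite fine_gt0// phi'fin andbT lt0e b0 Lsup_norm_ge0.
Qed.

End upper_bound.

(** * The seminorm as an optimal constant, and the conclusion *)

Section seminorm.
Context {R : realType}.
Notation mu := (@lebesgue_measure R).
Variables (p alpha : R) (f : R -> R).
Hypothesis p1 : 1 <= p.
Hypothesis alpha0 : 0 < alpha.
Hypothesis alpha1 : alpha <= 1.
Hypothesis mf : measurable_fun setT f.
Hypothesis ffin : ('N[mu]_(p%:E)[EFin \o f] < +oo)%E.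
Local Open Scope ereal_scope.

Lemma besov_seminorm_ge0 : 0 <= besov_seminorm p alpha f.
Proof.
apply: (@le_trans _ _ ((`|1| `^ (- alpha))%:E *
    'N[mu]_(p%:E)[EFin \o (shift_by 1%R f \- f)%R])).
  by rewrite mule_ge0 ?Lnorm_ge0// lee_fin powR_ge0.
by apply: ereal_sup_ubound; exists 1%R => //=; rewrite oner_eq0.
Qed.

Lemma besov_seminorm_leP (s : R) : (0 <= s)%R ->
  besov_seminorm p alpha f <= s%:E <->
  forall h : R, 'N[mu]_(p%:E)[EFin \o (shift_by h f \- f)%R] <= (s * `|h| `^ alpha)%:E.
Proof.
move=> s0; split=> [H h|H].
  (* The seminorm leaves out h = 0, where both sides vanish because alpha > 0. *)
  have [->|h0] := eqVneq h 0%R.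
    rewrite normr0 powR0 ?gt_eqF// mulr0 (_ : EFin \o _ = cst 0).
      by rewrite Lnorm0// eqe gt_eqF// (lt_le_trans ltr01).
    by apply/funext => x; rewrite /= /shift_by subr0 subrr.
  have ha : (0 < `|h| `^ alpha)%R by rewrite powR_gt0 ?normr_gt0.
  have : (`|h| `^ (- alpha))%:E *
      'N[mu]_(p%:E)[EFin \o (shift_by h f \- f)%R] <= s%:E.
    by apply: le_trans H; apply: ereal_sup_ubound; exists h.
  by rewrite powRN lee_pdivrMl// -EFinM mulrC.
apply: ge_ereal_sup => _ [h /= h0 <-].
have ha : (0 < `|h| `^ alpha)%R by rewrite powR_gt0 ?normr_gt0.
by rewrite powRN lee_pdivrMl// -EFinM mulrC.
Qed.

Lemma Vvar_le : Vvar p alpha f <= ((1 + alpha)^-1 + 1)%:E * besov_seminorm p alpha f.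
Proof.
have c0 : (0 < (1 + alpha)^-1 + 1)%R by rewrite addr_gt0// invr_gt0 addr_gt0.
(* If the seminorm is infinite, so is the right side, its constant being positive. *)
have := besov_seminorm_ge0; case E : (besov_seminorm p alpha f) => [s||]// s0; last first.
  by rewrite gt0_muley ?lte_fin// leey.
have Hs := iffLR (besov_seminorm_leP s0); rewrite E in Hs.
rewrite -EFinM; apply: ereal_inf_lbound.
exists (((1 + alpha)^-1 + 1) * s)%R => //; split; first by rewrite mulr_ge0// ltW.
move=> phi /set_mem tphi; exact: integral_derive1_le (Hs (lexx _)) _ tphi.
Qed.

(** V is an infimum, so it suffices to bound every admissible C from below; the factor 2^(alpha - 1)
    cancels the 2^(1 - alpha) of [Lnorm_shift_by_le]. *)
Lemma le_Vvar : (2 `^ (alpha - 1))%:E * besov_seminorm p alpha f <= Vvar p alpha f.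
Proof.
apply: le_ereal_inf_tmp => _ [C [C0 HC] <-].
have HC' phi : test_function phi -> _ := fun tphi => HC phi (mem_set tphi).
have s0 : (0 <= 2 `^ (1 - alpha) * C)%R by rewrite mulr_ge0 ?powR_ge0.
have H : besov_seminorm p alpha f <= (2 `^ (1 - alpha) * C)%:E.
  apply: ge_ereal_sup => _ [h /= h0 <-].
  have ha : (0 < `|h| `^ alpha)%R by rewrite powR_gt0 ?normr_gt0.
  by rewrite powRN lee_pdivrMl// -EFinM mulrC; exact: Lnorm_shift_by_le.
apply: (le_trans (lee_wpmul2l _ H)); first by rewrite lee_fin powR_ge0.
rewrite -EFinM lee_fin mulrA -powRD; last by rewrite pnatr_eq0 implybT.
by rewrite addrC subrKA subrr powRr0 mul1r.
Qed.

Lemma Vvar_ltyP : f \in nikolskii_besov p alpha <-> Vvar p alpha f < +oo.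
Proof.
have fL : f \in Lfun mu p%:E by rewrite inE; apply/andP; split; rewrite inE.
split=> [/set_mem[_ [C HC]]|Vfin].
  apply: (le_lt_trans Vvar_le); rewrite lte_mul_pinfty//.
    by rewrite lee_fin addr_ge0// invr_ge0 addr_ge0// ltW.
  (* The class allows any real C; the estimate at h = 1 shows that it is nonnegative. *)
  have C0 : (0 <= C)%R.
    by have := le_trans (Lnorm_ge0 _ _ _) (HC 1%R); rewrite lee_fin normr1 powR1 mulr1.
  exact: (le_lt_trans (iffRL (besov_seminorm_leP C0) HC) (ltry _)).
apply: mem_set; split => //.
have sfin : besov_seminorm p alpha f < +oo.
  have := le_lt_trans le_Vvar Vfin.
  have := besov_seminorm_ge0; case: besov_seminorm => [r _ _||]//; first exact: ltry.
  by rewrite gt0_muley// lte_fin powR_gt0.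
exists (fine (besov_seminorm p alpha f)).
apply: (iffLR (besov_seminorm_leP _)); first by rewrite fine_ge0 ?besov_seminorm_ge0.
by rewrite fineK// ge0_fin_numE ?besov_seminorm_ge0.
Qed.

End seminorm.

Theorem theorem2p2 (R : realType) (p alpha : R) (f : R -> R)
  (hp : 1 <= p) (halpha0 : 0 < alpha) (halpha1 : alpha <= 1)
  (hf : f \in Lfun (@lebesgue_measure R) p%:E) :
  (f \in nikolskii_besov p alpha <-> (Vvar p alpha f < +oo)%E) /\
  ((2 `^ (alpha - 1))%:E * besov_seminorm p alpha f <= Vvar p alpha f)%E /\
  (Vvar p alpha f <= ((1 + alpha)^-1 + 1)%:E * besov_seminorm p alpha f)%E.
Proof.
have [mf ffin] : measurable_fun setT f /\ ('N[@lebesgue_measure R]_(p%:E)[EFin \o f] < +oo)%E.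
  by move: hf; rewrite inE => /andP[/set_mem mf /set_mem].
by split; [exact: Vvar_ltyP|split; [exact: le_Vvar|exact: Vvar_le]].
Qed.
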